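(* Let $m\ge3$ be an odd integer and $n=2m$, and let $0<\lambda<1$. Let $\varphi:(0,1)\to(0,1)$ be continuous with $\lim_{r\to0^+}\varphi(r)=0$. Then there exists a $C^\infty$ positive solution $u$ of $$0\le-\Delta^m u\le e^{u^\lambda}\quad\text{in }\mathbb{R}^n\setminus\{0\}$$ such that $u(x)\neq O\left(\varphi(|x|)|x|^{-\frac{n-2}{1-\lambda}}\right)$ as $x\to0$.
   Context: $\Delta^m$ is the $m$-fold iterated Laplacian. For positive functions, ''$u(x)\neq O(h(x))$ as $x\to0$'' means $\limsup_{x\to0} u(x)/h(x)=\infty$. *)

(* Defs.v *)
From Stdlib Require Import Reals Lra Arith.
Open Scope R_scope.

(* Points of R^n are represented as [nat -> R]; only coordinates 0..n-1
   matter, the others are required to be 0 (see [in_Rn]). *)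
Definition vec := nat -> R.

Definition upd (x : vec) (i : nat) (t : R) : vec :=
  fun j => if Nat.eqb j i then t else x j.

Fixpoint sumR (n : nat) (f : nat -> R) : R :=
  match n with O => 0 | S k => sumR k f + f k end.

Definition norm (n : nat) (x : vec) : R := sqrt (sumR n (fun i => x i ^ 2)).

Definition in_Rn (n : nat) (x : vec) : Prop := forall i, (n <= i)%nat -> x i = 0.

Definition punct (n : nat) (x : vec) : Prop := in_Rn n x /\ 0 < norm n x.

Definition cont_on (n : nat) (U : vec -> Prop) (f : vec -> R) : Prop :=
  forall x, U x -> forall eps, 0 < eps -> exists delta, 0 < delta /\
    forall y, U y -> norm n (fun i => y i - x i) < delta -> Rabs (f y - f x) < eps.

Definition is_partial (U : vec -> Prop) (f : vec -> R) (i : nat) (g : vec -> R) : Prop :=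
  forall x, U x -> derivable_pt_lim (fun t => f (upd x i t)) (x i) (g x).

(* C^infinity on U: all iterated partial derivatives exist and are continuous.
   D l is the partial derivative along the (reversed) list of directions l. *)
Definition smooth_on (n : nat) (U : vec -> Prop) (f : vec -> R) : Prop :=
  exists D : list nat -> vec -> R,
    (forall x, U x -> D nil x = f x) /\
    forall l, cont_on n U (D l) /\
      forall i, (i < n)%nat -> is_partial U (D l) i (D (cons i l)).

Inductive lap_iter (n : nat) (U : vec -> Prop) : nat -> (vec -> R) -> (vec -> R) -> Prop :=
| lap_iter0 : forall u w, (forall x, U x -> w x = u x) -> lap_iter n U 0 u w
| lap_iterS : forall k u v (g1 g2 : nat -> vec -> R) w,
    lap_iter n U k u v ->
    (forall i, (i < n)%nat -> is_partial U v i (g1 i) /\ is_partial U (g1 i) i (g2 i)) ->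
    (forall x, U x -> w x = sumR n (fun i => g2 i x)) ->
    lap_iter n U (S k) u w.

(* Main.v *)
(* Peaks of polyharmonic bubbles accumulate at the origin. In dimension [n = 2m], [m] odd,
   [Delta^m ln (|x - y|^2 + r^2)] equals [c r^(2m) / (|x - y|^2 + r^2)^(2m)] with [c > 0].
   Let [F(x,t,h)] be [ln D], [D = |x - t e_0|^2 + t^2 h], minus its Taylor polynomial of
   degree [n - 3] in [t] at [t = 0]. The Taylor coefficients are smooth off [0] and
   annihilated by [Delta^m], because [Delta^m ln D = O(t^(2m))]. As [F] is homogeneous of
   degree [0] in [(x,t)] and [O(t^(n-2))] at [t = 0], one has [F <= C (t/|x|)^(n-2)]. Then
     [u = sum_j (2^(-j-1) |x|^(2-n) - M_j F(x,t_j,h_j))],  [M_j = eps_j t_j^(2-n)],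
   has positive terms if [eps_j] is a small multiple of [2^(-j)]. At [t_j e_0] it is about
   [M_j ln (1/h_j)]; the inequality [-Delta^m u <= exp (u^lam)] permits
   [ln (1/h_j) ~ M_j^(lam/(1-lam))], so that [u(t_j e_0)] is about
   [M_j^(1/(1-lam)) = eps_j^(1/(1-lam)) t_j^(-(n-2)/(1-lam))], and [t_j] is taken so small
   that [phi (t_j)] is negligible against [eps_j^(1/(1-lam)) / j]. *)
From Stdlib Require Import Reals Lra Lia Arith.
From Stdlib Require Import FunctionalExtensionality IndefiniteDescription PSeries_reg.
From Coquelicot Require Import Coquelicot.
Require Import Defs.
Open Scope R_scope.

(** The bubbles decouple. Every term of the series is positive, so u dominates each bubble
    separately, and bubble j only has to be controlled by the share 2^(-j-1) of exp (u^lam). No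
    interaction between bubbles is estimated, and only upper bounds on F are needed: that F is very
    negative near a centre helps. The order of the subtracted polynomial is fixed by the
    compensating term: |x|^(2-n) is harmonic, so Delta^m does not see it, and it pays for an error
    of size (t/|x|)^(n-2). Odd m enters through a sign, c being 4 (-4)^(m-1) (2m-1)!. The peak
    exponent is a balance. With L = ln (1/h), the density at a centre is exp (m L) up to powers of
    t, while u there is about M L; so L ~ (M L)^lam up to a constant, that is L ~
    M^(lam/(1-lam)). *)

(** * Finite sums and the squared norm *)

Lemma sumR_ext (n : nat) (f g : nat -> R) :
  (forall i, (i < n)%nat -> f i = g i) -> sumR n f = sumR n g.
Proof.
  induction n as [|n IH]; intros Hfg; simpl; [reflexivity|].
  rewrite IH, Hfg; auto.
Qed.

Lemma sumR_plus (n : nat) (f g : nat -> R) :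
  sumR n (fun i => f i + g i) = sumR n f + sumR n g.
Proof. induction n as [|n IH]; simpl; [ring | rewrite IH; ring]. Qed.

Lemma sumR_scal (n : nat) (c : R) (f : nat -> R) :
  sumR n (fun i => c * f i) = c * sumR n f.
Proof. induction n as [|n IH]; simpl; [ring | rewrite IH; ring]. Qed.

Lemma sumR_zero (n : nat) (f : nat -> R) :
  (forall i, (i < n)%nat -> f i = 0) -> sumR n f = 0.
Proof.
  induction n as [|n IH]; intros Hf; simpl; [reflexivity|].
  rewrite IH, Hf; auto; ring.
Qed.

Lemma sumR_const (n : nat) (c : R) : sumR n (fun _ => c) = INR n * c.
Proof.
  induction n as [|n IH]; [simpl; ring|].
  rewrite S_INR; simpl; rewrite IH; ring.
Qed.

Lemma sumR_le (n : nat) (f g : nat -> R) :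
  (forall i, (i < n)%nat -> f i <= g i) -> sumR n f <= sumR n g.
Proof.
  induction n as [|n IH]; intros Hfg; simpl; [lra|].
  apply Rplus_le_compat; auto.
Qed.

Lemma sumR_term_le (n : nat) (f : nat -> R) (i : nat) :
  (forall j, 0 <= f j) -> (i < n)%nat -> f i <= sumR n f.
Proof.
  intros Hf; induction n as [|n IH]; intros Hi; [lia|]; simpl.
  assert (Hs : forall k, 0 <= sumR k f).
  { induction k; simpl; [lra | specialize (Hf k); lra]. }
  destruct (Nat.eq_dec i n) as [->|Hne].
  - specialize (Hs n); lra.
  - assert (f i <= sumR n f) by (apply IH; lia). specialize (Hf n); lra.
Qed.

Lemma sumR_single (n : nat) (f : nat -> R) (i : nat) :
  (i < n)%nat -> (forall j, j <> i -> f j = 0) -> sumR n f = f i.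
Proof.
  induction n as [|n IH]; intros Hi Hf; [lia|]; simpl.
  destruct (Nat.eq_dec i n) as [->|Hne].
  - rewrite sumR_zero; [ring | intros j Hj; apply Hf; lia].
  - rewrite IH, (Hf n); auto; [ring | lia].
Qed.

Definition kron (i j : nat) : R := if Nat.eqb i j then 1 else 0.

Definition nsq (n : nat) (x : vec) : R := sumR n (fun i => x i ^ 2).

Lemma nsq_nonneg (n : nat) (x : vec) : 0 <= nsq n x.
Proof.
  unfold nsq; rewrite <- (sumR_zero n (fun _ => 0)); [|auto].
  apply sumR_le; intros; nra.
Qed.

Lemma nsq_coord (n : nat) (x : vec) (i : nat) : (i < n)%nat -> x i ^ 2 <= nsq n x.
Proof. intros Hi; apply (sumR_term_le n (fun i => x i ^ 2)); auto; intros; nra. Qed.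

Lemma nsq_upd (n : nat) (x : vec) (i : nat) (s : R) :
  (i < n)%nat -> nsq n (upd x i s) = nsq n x - x i ^ 2 + s ^ 2.
Proof.
  unfold nsq; induction n as [|n IH]; intros Hi; [lia|].
  cbn [sumR].
  destruct (Nat.eq_dec i n) as [->|Hne].
  - rewrite (sumR_ext n _ (fun j => x j ^ 2)).
    + unfold upd at 1; rewrite Nat.eqb_refl; ring.
    + intros j Hj; unfold upd; destruct (Nat.eqb_spec j n); [lia | reflexivity].
  - rewrite IH by lia; unfold upd at 1.
    destruct (Nat.eqb_spec n i); [lia | ring].
Qed.

Lemma upd_same (x : vec) (i : nat) : upd x i (x i) = x.
Proof.
  apply functional_extensionality; intros j; unfold upd.
  destruct (Nat.eqb_spec j i); subst; reflexivity.
Qed.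

(** * A symbolic differential calculus in (x,t) *)

(* [D = |x - t e_0|^2 + t^2 h]. *)
Definition quad (n : nat) (x : vec) (t h : R) : R :=
  nsq n x - 2 * t * x 0%nat + t ^ 2 * (1 + h).

(* A class of functions of [(x,t,h)] containing [ln D] and closed under differentiation, in which
   commutation of derivatives and locally uniform bounds follow by structural induction. *)
Inductive expr : Type :=
| Cst (c : R) | X (i : nat) | T | H
| Add (e1 e2 : expr) | Mul (e1 e2 : expr) | Inv | Log.

Fixpoint ev (n : nat) (e : expr) (x : vec) (t h : R) : R :=
  match e with
  | Cst c => c
  | X i => x i
  | T => t
  | H => h
  | Add e1 e2 => ev n e1 x t h + ev n e2 x t h
  | Mul e1 e2 => ev n e1 x t h * ev n e2 x t h
  | Inv => / quad n x t h
  | Log => ln (quad n x t h)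
  end.

(** There is no direction for h: it is a parameter of the bubble and is never differentiated. *)
Inductive dir : Type := DX (i : nat) | DT.

Definition dquad (n : nat) (a : dir) : expr :=
  match a with
  | DX i => if Nat.ltb i n
            then Add (Mul (Cst 2) (X i)) (Mul (Cst (-2 * kron i 0)) T) else Cst 0
  | DT => Add (Mul (Cst (-2)) (X 0)) (Mul (Cst 2) (Mul T (Add (Cst 1) H)))
  end.

Fixpoint d (n : nat) (a : dir) (e : expr) : expr :=
  match e with
  | Cst _ => Cst 0
  | X j => match a with DX i => Cst (kron i j) | DT => Cst 0 end
  | T => match a with DX _ => Cst 0 | DT => Cst 1 end
  | H => Cst 0
  | Add e1 e2 => Add (d n a e1) (d n a e2)
  | Mul e1 e2 => Add (Mul (d n a e1) e2) (Mul e1 (d n a e2))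
  | Inv => Mul (Cst (-1)) (Mul (dquad n a) (Mul Inv Inv))
  | Log => Mul (dquad n a) Inv
  end.

Lemma d_dquad_comm (n : nat) (a b : dir) (x : vec) (t h : R) : (0 < n)%nat ->
  ev n (d n a (dquad n b)) x t h = ev n (d n b (dquad n a)) x t h.
Proof.
  intros Hn; destruct a as [i|], b as [j|]; simpl;
    repeat match goal with |- context [Nat.ltb ?i n] => destruct (Nat.ltb_spec i n) end;
    simpl; try ring; unfold kron;
    repeat match goal with |- context [Nat.eqb ?i ?j] => destruct (Nat.eqb_spec i j) end;
    subst; try lia; try ring.
Qed.

(** The rules of [d] are algebraic, so no Schwarz theorem is involved: at [Inv] and [Log] the claim
    reduces to symmetry of the second derivatives of D. *)
Lemma d_comm (n : nat) (a b : dir) (e : expr) (x : vec) (t h : R) : (0 < n)%nat ->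
  ev n (d n a (d n b e)) x t h = ev n (d n b (d n a e)) x t h.
Proof.
  intros Hn; pose proof (d_dquad_comm n a b x t h Hn) as Hq.
  induction e; simpl; try reflexivity.
  - destruct a, b; reflexivity.
  - destruct a, b; reflexivity.
  - rewrite IHe1, IHe2; ring.
  - rewrite IHe1, IHe2; ring.
  - rewrite Hq; ring.
  - rewrite Hq; ring.
Qed.

(** A spatial coordinate and t are moved through one interface, so that [ev_deriv] covers both. *)
Definition movex (a : dir) (x : vec) (s : R) : vec :=
  match a with DX i => upd x i s | DT => x end.
Definition movet (a : dir) (t s : R) : R := match a with DX _ => t | DT => s end.
Definition coord (a : dir) (x : vec) (t : R) : R :=
  match a with DX i => x i | DT => t end.
Definition valid (n : nat) (a : dir) : Prop :=
  match a with DX i => (i < n)%nat | DT => True end.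

Lemma movex_same (a : dir) (x : vec) (t : R) : movex a x (coord a x t) = x.
Proof. destruct a; simpl; auto using upd_same. Qed.

Lemma movet_same (a : dir) (x : vec) (t : R) : movet a t (coord a x t) = t.
Proof. destruct a; reflexivity. Qed.

Lemma quad_deriv (n : nat) (a : dir) (x : vec) (t h : R) : valid n a ->
  is_derive (fun s => quad n (movex a x s) (movet a t s) h) (coord a x t)
    (ev n (dquad n a) x t h).
Proof.
  destruct a as [i|]; simpl; intros Hv.
  - destruct (Nat.ltb_spec i n); [|lia].
    apply (is_derive_ext (fun s => nsq n x - x i ^ 2 + s ^ 2
      - 2 * t * (if Nat.eqb 0 i then s else x 0%nat) + t ^ 2 * (1 + h))).
    { intros s; unfold quad; rewrite nsq_upd by assumption; reflexivity. }
    cbn [ev coord Rplus]; unfold kron; rewrite (Nat.eqb_sym i 0).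
    destruct (Nat.eqb_spec 0 i); auto_derive; auto; ring.
  - unfold quad; auto_derive; auto; ring.
Qed.

Lemma ev_deriv (n : nat) (a : dir) (e : expr) (x : vec) (t h : R) :
  valid n a -> 0 < quad n x t h ->
  is_derive (fun s => ev n e (movex a x s) (movet a t s) h) (coord a x t)
    (ev n (d n a e) x t h).
Proof.
  intros Hv Hq.
  assert (Hx := movex_same a x t); assert (Ht := movet_same a x t).
  induction e; simpl.
  - apply (@is_derive_const R_AbsRing).
  - destruct a as [j|]; simpl; [|apply (@is_derive_const R_AbsRing)].
    unfold upd, kron; rewrite (Nat.eqb_sym j i).
    destruct (Nat.eqb i j); [apply (@is_derive_id R_AbsRing) | apply (@is_derive_const R_AbsRing)].
  - destruct a; simpl; [apply (@is_derive_const R_AbsRing) | apply (@is_derive_id R_AbsRing)].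
  - apply (@is_derive_const R_AbsRing).
  - apply (is_derive_plus (fun s => ev n e1 (movex a x s) (movet a t s) h)); assumption.
  - pose proof (is_derive_mult _ _ _ _ _ IHe1 IHe2 Rmult_comm) as Hm.
    cbv beta in Hm; rewrite Hx, Ht in Hm; exact Hm.
  - pose proof (is_derive_inv _ _ _ (quad_deriv n a x t h Hv)) as Hi.
    cbv beta in Hi; rewrite Hx, Ht in Hi.
    replace (-1 * _) with (- ev n (dquad n a) x t h / quad n x t h ^ 2)
      by (field; lra).
    apply Hi; lra.
  - apply (is_derive_comp ln (fun s => quad n (movex a x s) (movet a t s) h));
      [|apply quad_deriv, Hv].
    rewrite Hx, Ht; apply is_derive_ln, Hq.
Qed.

Lemma quad_pos_near (n : nat) (a : dir) (x : vec) (t h : R) :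
  valid n a -> 0 < quad n x t h ->
  locally (coord a x t) (fun s => 0 < quad n (movex a x s) (movet a t s) h).
Proof.
  intros Hv Hq.
  assert (Hc : continuous (fun s => quad n (movex a x s) (movet a t s) h) (coord a x t)).
  { apply (ex_derive_continuous (V := R_NormedModule)).
    eexists; apply quad_deriv, Hv. }
  apply (Hc (fun y => 0 < y)).
  rewrite movex_same, movet_same; apply open_gt, Hq.
Qed.

Definition eqv (n : nat) (e e' : expr) : Prop :=
  forall x t h, 0 < quad n x t h -> ev n e x t h = ev n e' x t h.

(** Both symbolic derivatives compute the true derivative, and D > 0 persists nearby. This allows
    closed forms to be substituted under [d]. *)
Lemma d_eqv (n : nat) (a : dir) (e e' : expr) :
  valid n a -> eqv n e e' -> eqv n (d n a e) (d n a e').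
Proof.
  intros Hv He x t h Hq.
  pose proof (ev_deriv n a e x t h Hv Hq) as H1.
  pose proof (ev_deriv n a e' x t h Hv Hq) as H2.
  rewrite <- (is_derive_unique _ _ _ H1); symmetry; rewrite <- (is_derive_unique _ _ _ H2).
  symmetry; apply Derive_ext_loc.
  generalize (quad_pos_near n a x t h Hv Hq); apply filter_imp.
  intros s Hs; apply He, Hs.
Qed.

(* Equality on the slice [t = 0], where [D = |x|^2]: only tangential derivatives respect it. *)
Definition eqv0 (n : nat) (e e' : expr) : Prop :=
  forall x h, 0 < quad n x 0 h -> ev n e x 0 h = ev n e' x 0 h.

Lemma d_eqv0 (n : nat) (i : nat) (e e' : expr) :
  (i < n)%nat -> eqv0 n e e' -> eqv0 n (d n (DX i) e) (d n (DX i) e').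
Proof.
  intros Hv He x h Hq.
  pose proof (ev_deriv n (DX i) e x 0 h Hv Hq) as H1.
  pose proof (ev_deriv n (DX i) e' x 0 h Hv Hq) as H2.
  rewrite <- (is_derive_unique _ _ _ H1); symmetry; rewrite <- (is_derive_unique _ _ _ H2).
  symmetry; apply Derive_ext_loc.
  generalize (quad_pos_near n (DX i) x 0 h Hv Hq); apply filter_imp.
  intros s Hs; apply He, Hs.
Qed.

Lemma ev_bounded (n : nat) (e : expr) (k K : R) : 0 < k ->
  exists C, 0 <= C /\ forall x t h, (forall i, Rabs (x i) <= K) -> Rabs t <= K -> Rabs h <= K ->
    k <= quad n x t h <= K -> Rabs (ev n e x t h) <= C.
Proof.
  intros Hk; induction e; simpl.
  - exists (Rabs c); split; [apply Rabs_pos | intros; lra].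
  - exists (Rabs K); split; [apply Rabs_pos|]; intros x t h Hx _ _ _.
    eapply Rle_trans; [apply Hx | apply Rle_abs].
  - exists (Rabs K); split; [apply Rabs_pos|]; intros x t h _ Ht _ _.
    eapply Rle_trans; [apply Ht | apply Rle_abs].
  - exists (Rabs K); split; [apply Rabs_pos|]; intros x t h _ _ Hh _.
    eapply Rle_trans; [apply Hh | apply Rle_abs].
  - destruct IHe1 as (C1 & H1 & B1), IHe2 as (C2 & H2 & B2).
    exists (C1 + C2); split; [lra|]; intros x t h Hx Ht Hh Hq.
    eapply Rle_trans; [apply Rabs_triang|].
    apply Rplus_le_compat; auto.
  - destruct IHe1 as (C1 & H1 & B1), IHe2 as (C2 & H2 & B2).
    exists (C1 * C2); split; [nra|]; intros x t h Hx Ht Hh Hq.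
    rewrite Rabs_mult; apply Rmult_le_compat; auto using Rabs_pos.
  - exists (/ k); split; [left; apply Rinv_0_lt_compat, Hk|]; intros x t h _ _ _ Hq.
    rewrite Rabs_pos_eq; [apply Rinv_le_contravar; lra|].
    left; apply Rinv_0_lt_compat; lra.
  - exists (Rabs (ln k) + Rabs (ln K)); split.
    { pose proof (Rabs_pos (ln k)); pose proof (Rabs_pos (ln K)); lra. }
    intros x t h _ _ _ Hq.
    assert (ln k <= ln (quad n x t h)) by (apply ln_le; lra).
    assert (ln (quad n x t h) <= ln K) by (apply ln_le; lra).
    unfold Rabs; repeat destruct Rcase_abs; lra.
Qed.

(** * Iterated Laplacians of bubbles *)

Fixpoint sumE (n : nat) (f : nat -> expr) : expr :=
  match n with O => Cst 0 | S k => Add (sumE k f) (f k) end.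

Fixpoint epow (e : expr) (k : nat) : expr :=
  match k with O => Cst 1 | S k => Mul e (epow e k) end.

Definition lap (n : nat) (e : expr) : expr :=
  sumE n (fun i => d n (DX i) (d n (DX i) e)).
Definition laps (n k : nat) (e : expr) : expr := Nat.iter k (lap n) e.
Definition dts (n k : nat) (e : expr) : expr := Nat.iter k (d n DT) e.

Lemma ev_sumE (n k : nat) (f : nat -> expr) (x : vec) (t h : R) :
  ev n (sumE k f) x t h = sumR k (fun i => ev n (f i) x t h).
Proof. induction k as [|k IH]; simpl; congruence. Qed.

Lemma ev_epow (n : nat) (e : expr) (k : nat) (x : vec) (t h : R) :
  ev n (epow e k) x t h = ev n e x t h ^ k.
Proof. induction k as [|k IH]; simpl; congruence. Qed.

Lemma d_sumE (n k : nat) (a : dir) (f : nat -> expr) :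
  d n a (sumE k f) = sumE k (fun i => d n a (f i)).
Proof. induction k as [|k IH]; simpl; congruence. Qed.

Lemma eqv_trans (n : nat) (e1 e2 e3 : expr) : eqv n e1 e2 -> eqv n e2 e3 -> eqv n e1 e3.
Proof. intros H1 H2 x t h Hq; rewrite H1; auto. Qed.

Lemma lap_eqv (n : nat) (e e' : expr) : eqv n e e' -> eqv n (lap n e) (lap n e').
Proof.
  intros He x t h Hq; unfold lap; rewrite !ev_sumE; apply sumR_ext; intros i Hi.
  apply d_eqv; [exact Hi | apply d_eqv; [exact Hi | exact He] | exact Hq].
Qed.

Lemma lap_eqv0 (n : nat) (e e' : expr) : eqv0 n e e' -> eqv0 n (lap n e) (lap n e').
Proof.
  intros He x h Hq; unfold lap; rewrite !ev_sumE; apply sumR_ext; intros i Hi.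
  apply d_eqv0; [exact Hi | apply d_eqv0; [exact Hi | exact He] | exact Hq].
Qed.

Lemma dts_eqv (n k : nat) (e e' : expr) : eqv n e e' -> eqv n (dts n k e) (dts n k e').
Proof.
  intros He; induction k as [|k IH]; [exact He|].
  apply (d_eqv n DT); [exact I | exact IH].
Qed.

Lemma d_dts_comm (n k : nat) (a : dir) (e : expr) : (0 < n)%nat -> valid n a ->
  eqv n (d n a (dts n k e)) (dts n k (d n a e)).
Proof.
  intros Hn Ha; induction k as [|k IH]; [intros x t h Hq; reflexivity|].
  apply eqv_trans with (d n DT (d n a (dts n k e))).
  - intros x t h Hq; apply d_comm, Hn.
  - apply (d_eqv n DT); [exact I | exact IH].
Qed.

Lemma d_lap_comm (n : nat) (e : expr) : (0 < n)%nat ->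
  eqv n (lap n (d n DT e)) (d n DT (lap n e)).
Proof.
  intros Hn x t h Hq; unfold lap; rewrite d_sumE, !ev_sumE.
  apply sumR_ext; intros i Hi.
  transitivity (ev n (d n (DX i) (d n DT (d n (DX i) e))) x t h); [|apply d_comm, Hn].
  apply d_eqv; [exact Hi | | exact Hq].
  intros y s g Hy; apply d_comm, Hn.
Qed.

(** This carries Delta^m onto the Taylor coefficients in t: they become t-derivatives of Delta^m ln
    D. *)
Lemma laps_dts_comm (n j k : nat) (e : expr) : (0 < n)%nat ->
  eqv n (laps n j (dts n k e)) (dts n k (laps n j e)).
Proof.
  intros Hn; revert j; induction k as [|k IHk]; intros j; [intros x t h Hq; reflexivity|].
  apply eqv_trans with (d n DT (laps n j (dts n k e))).
  - induction j as [|j IHj]; [intros x t h Hq; reflexivity|].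
    apply eqv_trans with (lap n (d n DT (laps n j (dts n k e)))).
    + apply lap_eqv, IHj.
    + apply d_lap_comm, Hn.
  - apply (d_eqv n DT); [exact I | apply IHk].
Qed.

Lemma ev_d_powInv (n p : nat) (a : dir) (x : vec) (t h : R) :
  ev n (d n a (epow Inv p)) x t h =
  - INR p * ev n (dquad n a) x t h * (/ quad n x t h) ^ S p.
Proof.
  induction p as [|p IH]; [simpl; ring|].
  rewrite S_INR; cbn [epow d ev]; rewrite IH, ev_epow; simpl; ring.
Qed.

(** This is |grad D|^2 = 4 |x - t e_0|^2. *)
Lemma sum_dquad_sq (n : nat) (x : vec) (t h : R) : (0 < n)%nat ->
  sumR n (fun i => ev n (dquad n (DX i)) x t h ^ 2) = 4 * (quad n x t h - t ^ 2 * h).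
Proof.
  intros Hn.
  rewrite (sumR_ext n _ (fun i => 4 * (x i) ^ 2 + kron i 0 * (-8 * t * x 0%nat + 4 * t ^ 2))).
  - rewrite sumR_plus, sumR_scal, (sumR_single n (fun i => kron i 0 * _) 0 Hn).
    + unfold quad, nsq, kron; simpl; ring.
    + intros j Hj; unfold kron; destruct (Nat.eqb_spec j 0); [lia | ring].
  - intros i Hi; simpl; destruct (Nat.ltb_spec i n); [|lia].
    unfold kron; destruct (Nat.eqb_spec i 0); subst; simpl; ring.
Qed.

Lemma ev_dd_quad (n i : nat) (x : vec) (t h : R) : (i < n)%nat ->
  ev n (d n (DX i) (dquad n (DX i))) x t h = 2.
Proof.
  intros Hi; simpl; destruct (Nat.ltb_spec i n); [|lia].
  simpl; unfold kron at 1; rewrite Nat.eqb_refl; ring.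
Qed.

(** From Delta D = 2n and |grad D|^2 = 4 (D - t^2 h). For n = 2m and p = m - 1 the first coefficient
    vanishes; at t = 0 this is the harmonicity of |x|^(2-n). *)
Lemma ev_lap_powInv (n p : nat) (x : vec) (t h : R) : (0 < n)%nat -> 0 < quad n x t h ->
  ev n (lap n (epow Inv p)) x t h =
  - INR p * ((2 * INR n - 4 * (INR p + 1)) * (/ quad n x t h) ^ S p
             + 4 * (INR p + 1) * (t ^ 2 * h) * (/ quad n x t h) ^ S (S p)).
Proof.
  intros Hn Hq; unfold lap; rewrite ev_sumE.
  rewrite (sumR_ext n _ (fun i => - INR p * (/ quad n x t h) ^ S p * 2
     + INR p * (INR p + 1) * (/ quad n x t h) ^ S (S p) * ev n (dquad n (DX i)) x t h ^ 2)).
  - rewrite sumR_plus, sumR_const, sumR_scal, sum_dquad_sq by exact Hn.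
    simpl; field; lra.
  - intros i Hi.
    (* A closed form of the first derivative, so that the second one is again an instance of
       [ev_d_powInv]. *)
    set (e := Mul (Cst (- INR p)) (Mul (dquad n (DX i)) (epow Inv (S p)))).
    transitivity (ev n (d n (DX i) e) x t h).
    + apply d_eqv; [exact Hi | | exact Hq].
      intros y s g Hy; rewrite ev_d_powInv; unfold e; cbn [ev].
      rewrite ev_epow; simpl; ring.
    + unfold e; cbn [d ev]; rewrite ev_d_powInv, ev_dd_quad, ev_epow, S_INR by exact Hi.
      cbn [ev]; simpl; ring.
Qed.

Lemma ev_lap_Log (n : nat) (x : vec) (t h : R) : (0 < n)%nat -> 0 < quad n x t h ->
  ev n (lap n Log) x t h =
  (2 * INR n - 4) * / quad n x t h + 4 * (t ^ 2 * h) * (/ quad n x t h) ^ 2.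
Proof.
  intros Hn Hq; unfold lap; rewrite ev_sumE.
  rewrite (sumR_ext n _ (fun i => / quad n x t h * 2
     + - (/ quad n x t h) ^ 2 * ev n (dquad n (DX i)) x t h ^ 2)).
  - rewrite sumR_plus, sumR_const, sumR_scal, sum_dquad_sq by exact Hn.
    simpl; field; lra.
  - intros i Hi; cbn [d ev]; rewrite ev_dd_quad by exact Hi; ring.
Qed.

Lemma lap_Mul_const (n : nat) (A e : expr) :
  (forall i x t h, ev n (d n (DX i) A) x t h = 0) ->
  eqv n (lap n (Mul A e)) (Mul A (lap n e)).
Proof.
  intros HA x t h Hq; unfold lap; cbn [ev]; rewrite !ev_sumE.
  rewrite <- sumR_scal; apply sumR_ext; intros i Hi.
  transitivity (ev n (d n (DX i) (Mul A (d n (DX i) e))) x t h).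
  - apply d_eqv; [exact Hi | | exact Hq].
    intros y s g Hy; cbn [d ev]; rewrite HA; ring.
  - cbn [d ev]; rewrite HA; ring.
Qed.

Lemma lap_sumE (n k : nat) (f : nat -> expr) (x : vec) (t h : R) :
  ev n (lap n (sumE k f)) x t h = sumR k (fun j => ev n (lap n (f j)) x t h).
Proof.
  unfold lap; induction k as [|k IH]; simpl.
  - rewrite ev_sumE; apply sumR_zero; intros; reflexivity.
  - rewrite <- IH, !ev_sumE, <- sumR_plus; apply sumR_ext; reflexivity.
Qed.

(* [bcoef m k i = C(k,i) (m-i-1) ... (m-k)]; up to factors this is the coefficient of
   [(t^2 h)^i D^(-k-i)] in [Delta^k ln D]. *)
Fixpoint bcoef (m k i : nat) : R :=
  match k with
  | O => if Nat.eqb i 0 then 1 else 0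
  | S k' => (INR m - 1 - INR k' - INR i) * bcoef m k' i +
            match i with O => 0 | S i' => bcoef m k' i' end
  end.

Lemma bcoef_gt (m k i : nat) : (k < i)%nat -> bcoef m k i = 0.
Proof.
  revert i; induction k as [|k IH]; intros i Hi; simpl.
  - destruct (Nat.eqb_spec i 0); [lia | reflexivity].
  - rewrite IH by lia; destruct i as [|i]; [lia|].
    rewrite IH by lia; ring.
Qed.

Lemma bcoef_diag (m k : nat) : bcoef m k k = 1.
Proof.
  induction k as [|k IH]; [reflexivity|].
  cbn [bcoef]; rewrite bcoef_gt, IH by lia; ring.
Qed.

(** The ratio of the closed forms at k + 1 and k, cleared of denominators. Its factor m - k - 1
    vanishes at k = m - 1, which kills all lower coefficients of Delta^m ln D. *)
Lemma bcoef_step (m k i : nat) :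
  (INR k + 1 - INR i) * bcoef m (S k) i = (INR k + 1) * (INR m - INR k - 1) * bcoef m k i.
Proof.
  revert i; induction k as [|k IH]; intros i.
  - destruct i as [|[|i]]; simpl; try ring.
  - pose proof (IH i) as IHi.
    set (p := fun j => match i with O => 0 | S i' => bcoef m j i' end).
    assert (IHp : (INR k + 2 - INR i) * p (S k) = (INR k + 1) * (INR m - INR k - 1) * p k).
    { unfold p; destruct i as [|i]; [ring|]. rewrite <- IH, S_INR; ring. }
    change (bcoef m (S (S k)) i) with
      ((INR m - 1 - INR (S k) - INR i) * bcoef m (S k) i + p (S k)).
    change (bcoef m (S k) i) with
      ((INR m - 1 - INR k - INR i) * bcoef m k i + p k) in *.
    rewrite S_INR; apply Rminus_diag_uniq.
    (* The defect of the claim is a linear combination of the defects of the induction hypothesis at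
       i - 1 and at i. *)
    transitivity (((INR k + 2 - INR i) * p (S k) - (INR k + 1) * (INR m - INR k - 1) * p k)
      + (INR m - 1 - INR k - INR i) *
        ((INR k + 1 - INR i) * ((INR m - 1 - INR k - INR i) * bcoef m k i + p k)
         - (INR k + 1) * (INR m - INR k - 1) * bcoef m k i)); [ring|].
    rewrite IHp, IHi; ring.
Qed.

Lemma bcoef_top (m i : nat) : (0 < m)%nat -> (i < m)%nat -> bcoef m m i = 0.
Proof.
  intros Hm Hi; destruct m as [|k]; [lia|].
  pose proof (bcoef_step (S k) k i) as Hs; rewrite S_INR in Hs.
  assert (INR i <= INR k) by (apply le_INR; lia).
  replace ((INR k + 1) * _ * _) with 0 in Hs by ring.
  apply Rmult_integral in Hs; destruct Hs; [lra | assumption].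
Qed.

Lemma sumR_shift (n : nat) (f : nat -> R) :
  sumR (S n) f = f 0%nat + sumR n (fun i => f (S i)).
Proof. induction n as [|n IH]; [simpl; ring|]. cbn [sumR] in *; rewrite IH; ring. Qed.

(** These belong to Delta^(k+1), not Delta^k. Applying Delta to D^(-p) with p = k + 1 + i yields
    factors p, which build up the factorial, and -4, which build up the power; the factors m - 1 - p
    go into [bcoef]. *)
Definition lapcoef (m k i : nat) : R :=
  4 * (-4) ^ k * INR (fact (k + i)) * bcoef m (S k) i.

Lemma laps_Log (m k : nat) : (0 < m)%nat ->
  eqv (2 * m) (laps (2 * m) (S k) Log)
    (sumE (S (S k)) (fun i => Mul (Mul (Cst (lapcoef m k i)) (epow (Mul (Mul T T) H) i))
                                  (epow Inv (S k + i)))).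
Proof.
  intros Hm; set (n := (2 * m)%nat).
  assert (Hn : (0 < n)%nat) by (unfold n; lia).
  assert (HnR : INR n = 2 * INR m) by (unfold n; rewrite mult_INR; reflexivity).
  induction k as [|k IH]; intros x t h Hq.
  - change (laps n 1 Log) with (lap n Log).
    rewrite ev_lap_Log, ev_sumE, HnR by assumption.
    unfold lapcoef; simpl; field; lra.
  - change (laps n (S (S k)) Log) with (lap n (laps n (S k) Log)).
    rewrite (lap_eqv n _ _ IH x t h Hq), lap_sumE, ev_sumE.
    set (v := / quad n x t h); set (s := t ^ 2 * h).
    (* Delta of the i-th term has a part with the same power of s and a part with one more; A and B
       collect them, B with its index shifted by one. *)
    set (A := fun i => 4 * (-4) ^ S k * INR (fact (S k + i)) *
      ((INR m - 1 - INR (S k) - INR i) * bcoef m (S k) i) * s ^ i * v ^ (S (S k) + i)).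
    set (B := fun i => 4 * (-4) ^ S k * INR (fact (S k + i)) *
      match i with O => 0 | S i' => bcoef m (S k) i' end * s ^ i * v ^ (S (S k) + i)).
    transitivity (sumR (S (S (S k))) A + sumR (S (S (S k))) B).
    + rewrite (sumR_shift _ B).
      replace (B 0%nat) with 0 by (unfold B; ring).
      assert (HA : A (S (S k)) = 0) by (unfold A; rewrite bcoef_gt by lia; ring).
      change (sumR (S (S (S k))) A) with (sumR (S (S k)) A + A (S (S k))); rewrite HA, Rplus_0_r.
      rewrite Rplus_0_l, <- sumR_plus; apply sumR_ext; intros i Hi.
      rewrite lap_Mul_const; [| |exact Hq].
      2: { intros j y r g; cbn [d ev].
           assert (Hp : ev n (d n (DX j) (epow (Mul (Mul T T) H) i)) y r g = 0).
           { induction i as [|i IHi]; simpl; [reflexivity|]; rewrite IHi by lia; ring. }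
           rewrite Hp; ring. }
      cbn [ev]; rewrite ev_lap_powInv, ev_epow by assumption.
      fold v; cbn [ev].
      replace (t * t * h) with s by (unfold s; ring); fold s.
      unfold A, B, lapcoef.
      replace (S k + S i)%nat with (S (S k + i)) by lia.
      replace (S (S k) + S i)%nat with (S (S (S k + i))) by lia.
      replace (S (S k) + i)%nat with (S (S k + i)) by lia.
      rewrite HnR, (fact_simpl (S k + i)), mult_INR.
      replace (S k + i)%nat with (S (k + i)) by lia.
      rewrite (fact_simpl (k + i)), mult_INR.
      rewrite !S_INR, plus_INR.
      generalize (INR (fact (k + i))) (bcoef m (S k) i) (INR k) (INR i) (INR m).
      intros a b c e f; rewrite <- !tech_pow_Rmult; ring.
    + rewrite <- sumR_plus; apply sumR_ext; intros i Hi.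
      unfold A, B; cbn [ev]; rewrite !ev_epow; cbn [ev]; fold v.
      replace (t * t * h) with s by (unfold s; ring).
      unfold lapcoef.
      change (bcoef m (S (S k)) i) with ((INR m - 1 - INR (S k) - INR i) * bcoef m (S k) i +
        match i with O => 0 | S i' => bcoef m (S k) i' end).
      ring.
Qed.

(** In dimension 2m only the top coefficient survives, by [bcoef_top]. The sign of (-4)^(m-1)
    decides the sign of Delta^m ln D. *)
Lemma laps_Log_top (m : nat) : (0 < m)%nat ->
  eqv (2 * m) (laps (2 * m) m Log)
    (Mul (Cst (4 * (-4) ^ (m - 1) * INR (fact (2 * m - 1))))
         (Mul (epow (Mul (Mul T T) H) m) (epow Inv (2 * m)))).
Proof.
  intros Hm x t h Hq.
  replace m with (S (m - 1)) at 3 by lia.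
  rewrite laps_Log, ev_sumE by assumption.
  rewrite (sumR_single _ _ m); [|lia|].
  2: { intros j Hj; cbn [ev]; unfold lapcoef; replace (S (m - 1)) with m by lia.
       destruct (Nat.lt_ge_cases j m) as [Hlt|Hge];
         [rewrite bcoef_top by lia | rewrite bcoef_gt by lia]; ring. }
  cbn [ev]; unfold lapcoef; replace (S (m - 1)) with m by lia.
  rewrite bcoef_diag.
  replace (m - 1 + m)%nat with (2 * m - 1)%nat by lia.
  replace (m + m)%nat with (2 * m)%nat by lia; ring.
Qed.

Lemma dts_succ (n k : nat) (e : expr) : dts n (S k) e = dts n k (d n DT e).
Proof. unfold dts; rewrite Nat.iter_succ_r; reflexivity. Qed.

Lemma ev_d_powT (n p : nat) (x : vec) (t h : R) :
  ev n (d n DT (epow T (S p))) x t h = (INR p + 1) * t ^ p.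
Proof.
  induction p as [|p IH]; [simpl; ring|].
  cbn [epow d ev] in *; rewrite IH, S_INR, ev_epow; simpl; ring.
Qed.

(** Each derivative costs one factor t. The derivative of t^(p+1) g is t^p ((p+1) g + t g'), so the
    induction runs over all g. *)
Lemma dts_vanish (n p k : nat) (g : expr) (x : vec) (h : R) :
  (k < p)%nat -> 0 < quad n x 0 h -> ev n (dts n k (Mul (epow T p) g)) x 0 h = 0.
Proof.
  revert p g; induction k as [|k IH]; intros p g Hk Hq.
  - destruct p as [|p]; [lia|]; simpl; ring.
  - destruct p as [|p]; [lia|].
    rewrite dts_succ.
    transitivity (ev n (dts n k (Mul (epow T p)
      (Add (Mul (Cst (INR p + 1)) g) (Mul T (d n DT g))))) x 0 h).
    + apply dts_eqv; [|exact Hq]; intros y s r Hy.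
      change (d n DT (Mul (epow T (S p)) g)) with
        (Add (Mul (d n DT (epow T (S p))) g) (Mul (epow T (S p)) (d n DT g))).
      cbn [ev]; rewrite ev_d_powT, !ev_epow; simpl; ring.
    + apply IH; [lia | exact Hq].
Qed.

(* The Taylor coefficients in [t] of order [< 2m] are [m]-polyharmonic since
   [Delta^m ln D = O(t^(2m))]. *)
Lemma laps_dts_Log_zero (m k : nat) (x : vec) (h : R) : (0 < m)%nat -> (k < 2 * m)%nat ->
  0 < quad (2 * m) x 0 h -> ev (2 * m) (laps (2 * m) m (dts (2 * m) k Log)) x 0 h = 0.
Proof.
  intros Hm Hk Hq.
  rewrite laps_dts_comm by (lia || exact Hq).
  rewrite (dts_eqv _ k _ (Mul (epow T (2 * m))
    (Mul (Cst (4 * (-4) ^ (m - 1) * INR (fact (2 * m - 1))))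
         (Mul (epow H m) (epow Inv (2 * m)))))); [apply dts_vanish; assumption | | exact Hq].
  eapply eqv_trans; [apply laps_Log_top, Hm|].
  intros y s r Hy; cbn [ev]; rewrite !ev_epow; cbn [ev].
  rewrite !Rpow_mult_distr, (pow_mult s 2 m).
  replace (s ^ 2) with (s * s) by ring; rewrite Rpow_mult_distr; ring.
Qed.

(** On the slice t = 0 the power is |x|^(2-n). For t and h nonzero D^(1-m) is not harmonic, so the
    argument has to stay within [eqv0]. *)
Lemma laps_power_zero (m k : nat) (x : vec) (h : R) : (0 < m)%nat -> (0 < k)%nat ->
  0 < quad (2 * m) x 0 h -> ev (2 * m) (laps (2 * m) k (epow Inv (m - 1))) x 0 h = 0.
Proof.
  intros Hm Hk; revert x h; change (eqv0 (2 * m) (laps (2 * m) k (epow Inv (m - 1))) (Cst 0)).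
  destruct k as [|k]; [lia|]; clear Hk; induction k as [|k IH]; intros x h Hq.
  - change (laps (2 * m) 1 (epow Inv (m - 1))) with (lap (2 * m) (epow Inv (m - 1))).
    rewrite ev_lap_powInv by (lia || exact Hq).
    rewrite mult_INR, minus_INR by lia; simpl; ring.
  - change (laps (2 * m) (S (S k)) (epow Inv (m - 1))) with
      (lap (2 * m) (laps (2 * m) (S k) (epow Inv (m - 1)))).
    rewrite (lap_eqv0 _ _ _ IH x h Hq).
    unfold lap; rewrite ev_sumE; apply sumR_zero; reflexivity.
Qed.

(** * Taylor remainders *)

Lemma is_derive_taylor_poly (N : nat) (c : nat -> R) (s : R) :
  is_derive (fun s => sumR (S N) (fun k => s ^ k / INR (fact k) * c k)) s
    (sumR N (fun k => s ^ k / INR (fact k) * c (S k))).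
Proof.
  induction N as [|N IH].
  - simpl; auto_derive; auto; ring.
  - apply (is_derive_plus (fun s => sumR (S N) (fun k => s ^ k / INR (fact k) * c k))
      (fun s => s ^ S N / INR (fact (S N)) * c (S N))); [exact IH|].
    pose proof (INR_fact_neq_0 N) as HN; pose proof (not_0_INR (S N) ltac:(lia)) as HS.
    assert (HF : INR (fact (S N)) = INR (S N) * INR (fact N)) by (rewrite fact_simpl; apply mult_INR).
    set (F := INR (fact (S N))) in *.
    auto_derive; [auto|].
    change (match N with O => 1 | S _ => INR N + 1 end) with (INR (S N)).
    change (Init.Nat.pred (S N)) with N; rewrite HF; field; auto.
Qed.

(** [f k] is the k-th derivative. The derivative of the remainder of [f 0] is the remainder of
    [f 1], so the mean value theorem gains one power of t per step; the factor 1/N! is dropped since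
    only the order in t matters. *)
Lemma taylor_bound (N : nat) (f : nat -> R -> R) (C t : R) : 0 <= C -> 0 <= t ->
  (forall k s, (k < N)%nat -> 0 <= s <= t -> is_derive (f k) s (f (S k) s)) ->
  (forall s, 0 <= s <= t -> Rabs (f N s) <= C) ->
  Rabs (f 0%nat t - sumR N (fun k => t ^ k / INR (fact k) * f k 0)) <= C * t ^ N.
Proof.
  intros HC; revert f t; induction N as [|N IH]; intros f t Ht Hd HN.
  - simpl; rewrite Rminus_0_r, Rmult_1_r; apply HN; lra.
  - set (g := fun s => f 0%nat s - sumR (S N) (fun k => s ^ k / INR (fact k) * f k 0)).
    set (g' := fun s => f 1%nat s - sumR N (fun k => s ^ k / INR (fact k) * f (S k) 0)).
    assert (Hg : forall s, 0 <= s <= t -> is_derive g s (g' s)).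
    { intros s Hs; apply (is_derive_minus (f 0%nat)); [apply Hd; [lia | exact Hs]|].
      apply (is_derive_taylor_poly N (fun k => f k 0)). }
    assert (Hg' : forall s, 0 <= s <= t -> Rabs (g' s) <= C * t ^ N).
    { intros s Hs; apply Rle_trans with (C * s ^ N).
      - apply (IH (fun k => f (S k))); [lra | |].
        + intros k r Hk Hr; apply Hd; [lia | lra].
        + intros r Hr; apply HN; lra.
      - apply Rmult_le_compat_l; [exact HC|]; apply pow_incr; lra. }
    assert (Hg0 : g 0 = 0).
    { unfold g; rewrite sumR_shift, sumR_zero; [simpl; field|].
      intros i Hi; simpl; unfold Rdiv; ring. }
    destruct (MVT_gen g 0 t g') as (c & Hc & Heq).
    + rewrite Rmin_left, Rmax_right by lra; intros s Hs; apply Hg; lra.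
    + rewrite Rmin_left, Rmax_right by lra; intros s Hs.
      apply continuity_pt_filterlim, (ex_derive_continuous (V := R_NormedModule)).
      eexists; apply Hg; lra.
    + rewrite Rmin_left, Rmax_right in Hc by lra.
      change (Rabs (g t) <= C * t ^ S N).
      replace (g t) with (g' c * t) by lra.
      rewrite Rabs_mult, (Rabs_pos_eq t) by lra.
      replace (C * t ^ S N) with (C * t ^ N * t) by (simpl; ring).
      apply Rmult_le_compat_r; auto.
Qed.

(** With N = n - 2 and e = [Log] this is F. A general e keeps the spatial derivatives of F in the
    same family. *)
Definition rem (n N : nat) (e : expr) (x : vec) (t h : R) : R :=
  ev n e x t h - sumR N (fun k => t ^ k / INR (fact k) * ev n (dts n k e) x 0 h).

Lemma quad_0 (n : nat) (x : vec) (h : R) : quad n x 0 h = nsq n x.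
Proof. unfold quad; ring. Qed.

Lemma quad_ge (n : nat) (x : vec) (t h : R) : (0 < n)%nat ->
  (x 0%nat - t) ^ 2 + t ^ 2 * h <= quad n x t h.
Proof. intros Hn; pose proof (nsq_coord n x 0 Hn); unfold quad; nra. Qed.

Lemma quad_pos (n : nat) (x : vec) (t h : R) : (0 < n)%nat -> 0 < t -> 0 < h ->
  0 < quad n x t h.
Proof.
  intros Hn Ht Hh; pose proof (quad_ge n x t h Hn).
  assert (0 < t ^ 2 * h) by (apply Rmult_lt_0_compat; [apply pow_lt; lra | lra]).
  pose proof (pow2_ge_0 (x 0%nat - t)); lra.
Qed.

(** For |x| >= 4t the cross term 2 t x_0 is at most |x|^2 / 2. Hence D stays comparable to |x|^2 on
    the whole segment from 0 to t used by Taylor's formula. *)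
Lemma quad_far (n : nat) (x : vec) (t h : R) : (0 < n)%nat -> 0 <= h <= 1 ->
  16 * t ^ 2 <= nsq n x -> / 2 * nsq n x <= quad n x t h <= 2 * nsq n x.
Proof.
  intros Hn Hh Ht; pose proof (nsq_coord n x 0 Hn) as H0; unfold quad.
  pose proof (pow2_ge_0 (x 0%nat - 4 * t)); pose proof (pow2_ge_0 (x 0%nat + 4 * t)).
  assert (0 <= t ^ 2 * h <= t ^ 2) by (pose proof (pow2_ge_0 t); nra).
  split; nra.
Qed.

Lemma coord_bound (n : nat) (x : vec) (K : R) (i : nat) : in_Rn n x ->
  nsq n x <= K -> Rabs (x i) <= K + 1.
Proof.
  intros Hx HK; pose proof (nsq_nonneg n x).
  destruct (Nat.lt_ge_cases i n) as [Hi|Hi].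
  - pose proof (nsq_coord n x i Hi) as Hc.
    rewrite <- (pow2_abs (x i)) in Hc; pose proof (Rabs_pos (x i)); nra.
  - rewrite Hx, Rabs_R0 by exact Hi; lra.
Qed.

Lemma rem_bound (n N : nat) (e : expr) (k K : R) : (0 < n)%nat -> 0 < k -> exists C, 0 <= C /\
  forall x t h, in_Rn n x -> k <= nsq n x <= K -> 0 <= h <= 1 -> 0 <= t -> 16 * t ^ 2 <= nsq n x ->
    Rabs (rem n N e x t h) <= C * t ^ N.
Proof.
  intros Hn Hk.
  destruct (ev_bounded n (dts n N e) (/ 2 * k) (2 * K + 1)) as (C & HC & HB); [lra|].
  exists C; split; [exact HC|]; intros x t h Hx Hq Hh Ht Htx.
  assert (Hs : forall s, 0 <= s <= t -> / 2 * k <= quad n x s h <= 2 * K + 1).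
  { intros s Hs; assert (s ^ 2 <= t ^ 2) by (apply pow_incr; lra).
    pose proof (quad_far n x s h Hn Hh); lra. }
  apply (taylor_bound N (fun k s => ev n (dts n k e) x s h)); try assumption.
  - intros j s Hj Hst; specialize (Hs s Hst).
    apply (ev_deriv n DT); [exact I | lra].
  - intros s Hst; specialize (Hs s Hst).
    assert (s ^ 2 <= t ^ 2) by (apply pow_incr; lra).
    apply HB; auto.
    + intros i; pose proof (coord_bound n x K i Hx); lra.
    + rewrite Rabs_pos_eq by lra; nra.
    + rewrite Rabs_pos_eq by lra; lra.
Qed.

Lemma rem_Add (n N : nat) (e1 e2 : expr) (x : vec) (t h : R) :
  rem n N (Add e1 e2) x t h = rem n N e1 x t h + rem n N e2 x t h.
Proof.
  unfold rem; cbn [ev].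
  rewrite (sumR_ext N _ (fun k => t ^ k / INR (fact k) * ev n (dts n k e1) x 0 h +
    t ^ k / INR (fact k) * ev n (dts n k e2) x 0 h)); [rewrite sumR_plus; ring|].
  intros k Hk; clear Hk; rewrite <- Rmult_plus_distr_l; f_equal.
  assert (Hd : dts n k (Add e1 e2) = Add (dts n k e1) (dts n k e2)).
  { induction k as [|k IH]; [reflexivity|].
    change (d n DT (dts n k (Add e1 e2)) = d n DT (Add (dts n k e1) (dts n k e2))).
    rewrite IH; reflexivity. }
  rewrite Hd; reflexivity.
Qed.

Lemma rem_deriv (n N i : nat) (e : expr) (x : vec) (t h : R) : (i < n)%nat ->
  0 < quad n x t h -> 0 < nsq n x ->
  is_derive (fun s => rem n N e (upd x i s) t h) (x i) (rem n N (d n (DX i) e) x t h).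
Proof.
  intros Hi Hq Hx; unfold rem.
  apply (is_derive_minus (fun s => ev n e (upd x i s) t h));
    [apply (ev_deriv n (DX i) e x t h Hi Hq)|].
  induction N as [|N IH]; simpl; [apply (@is_derive_const R_AbsRing)|].
  apply (is_derive_plus (fun s => sumR N (fun k => t ^ k / INR (fact k) *
    ev n (dts n k e) (upd x i s) 0 h))); [exact IH|].
  rewrite <- quad_0 with (h := h) in Hx.
  apply (is_derive_scal (fun s => ev n (dts n N e) (upd x i s) 0 h)).
  rewrite <- d_dts_comm by (simpl; (lia || exact Hi || exact Hx)).
  apply (ev_deriv n (DX i) (dts n N e) x 0 h Hi Hx).
Qed.

(** * Homogeneity and one-sided bounds for the remainder of ln D *)

Definition scalev (l : R) (x : vec) : vec := fun i => l * x i.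

Lemma nsq_scale (n : nat) (l : R) (x : vec) : nsq n (scalev l x) = l ^ 2 * nsq n x.
Proof.
  unfold nsq, scalev; rewrite <- sumR_scal; apply sumR_ext; intros; ring.
Qed.

Lemma quad_scale (n : nat) (l : R) (x : vec) (t h : R) :
  quad n (scalev l x) (l * t) h = l ^ 2 * quad n x t h.
Proof. unfold quad; rewrite nsq_scale; unfold scalev; ring. Qed.

(** Scaling adds 2 ln l to ln D, and the first t-derivative removes this constant. *)
Lemma dts_Log_scale (n k : nat) (l : R) (x : vec) (t h : R) : 0 < l -> 0 < quad n x t h ->
  l ^ k * ev n (dts n k Log) (scalev l x) (l * t) h =
  ev n (dts n k Log) x t h + match k with O => 2 * ln l | S _ => 0 end.
Proof.
  intros Hl; revert t; induction k as [|k IH]; intros t Hq.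
  - simpl; rewrite quad_scale, ln_mult by (try apply pow_lt; assumption).
    replace (ln (l ^ 2)) with (2 * ln l); [ring|].
    simpl; rewrite Rmult_1_r, ln_mult by assumption; ring.
  - assert (Hq' : 0 < quad n (scalev l x) (l * t) h).
    { rewrite quad_scale; apply Rmult_lt_0_compat; [apply pow_lt|]; assumption. }
    set (c := match k with O => 2 * ln l | S _ => 0 end) in IH.
    pose proof (ev_deriv n DT (dts n k Log) x t h I Hq) as H1.
    pose proof (ev_deriv n DT (dts n k Log) (scalev l x) (l * t) h I Hq') as H2.
    cbn [movex movet coord] in H1, H2.
    assert (H3 : is_derive (fun s => ev n (dts n k Log) x s h + c) t
      (ev n (dts n (S k) Log) x t h + 0)).
    { apply (is_derive_plus (fun s => ev n (dts n k Log) x s h) (fun _ => c));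
        [exact H1 | apply (@is_derive_const R_AbsRing)]. }
    assert (H4 : is_derive (fun s => l ^ k * ev n (dts n k Log) (scalev l x) (l * s) h) t
      (l ^ k * (l * ev n (dts n (S k) Log) (scalev l x) (l * t) h))).
    { apply (is_derive_scal (fun s => ev n (dts n k Log) (scalev l x) (l * s) h)).
      apply (is_derive_comp (fun s => ev n (dts n k Log) (scalev l x) s h) (fun s => l * s));
        [exact H2|]. auto_derive; auto; ring. }
    rewrite <- (is_derive_unique _ _ _ H3), <- tech_pow_Rmult, (Rmult_comm l), Rmult_assoc.
    rewrite <- (is_derive_unique _ _ _ H4).
    apply Derive_ext_loc.
    generalize (quad_pos_near n DT x t h I Hq); apply filter_imp.
    intros s Hs; apply IH, Hs.
Qed.

(** The constant 2 ln l also appears in the Taylor coefficient of order 0, present because N > 0,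
    and cancels. *)
Lemma rem_Log_scale (n N : nat) (l : R) (x : vec) (t h : R) : (0 < N)%nat -> 0 < l ->
  0 < quad n x t h -> 0 < nsq n x ->
  rem n N Log (scalev l x) (l * t) h = rem n N Log x t h.
Proof.
  intros HN Hl Hq Hx; unfold rem.
  pose proof (dts_Log_scale n 0 l x t h Hl Hq) as H0.
  simpl in H0; rewrite Rmult_1_l in H0.
  cbn [ev]; rewrite H0.
  rewrite (sumR_ext N (fun k => (l * t) ^ k / INR (fact k) * ev n (dts n k Log) (scalev l x) 0 h)
    (fun k => t ^ k / INR (fact k) * ev n (dts n k Log) x 0 h + kron k 0 * (2 * ln l))).
  - rewrite sumR_plus, (sumR_single N (fun k => kron k 0 * _) 0 HN).
    + unfold kron; simpl; ring.
    + intros j Hj; unfold kron; destruct (Nat.eqb_spec j 0); [lia | ring].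
  - intros k Hk.
    rewrite <- quad_0 with (h := h) in Hx.
    pose proof (dts_Log_scale n k l x 0 h Hl Hx) as Hd; rewrite Rmult_0_r in Hd.
    rewrite Rpow_mult_distr.
    replace (l ^ k * t ^ k / INR (fact k) * _) with
      (t ^ k / INR (fact k) * (l ^ k * ev n (dts n k Log) (scalev l x) 0 h)) by (unfold Rdiv; ring).
    rewrite Hd; destruct k; unfold kron; simpl; field.
    pose proof (INR_fact_neq_0 (S k)); assumption.
Qed.

(** When t is not small against |x|, D may come arbitrarily close to 0 between 0 and t and Taylor's
    formula gives nothing uniform in h. The polynomial is then estimated directly. *)
Lemma taylor_poly_bound (n N : nat) (e : expr) (k K : R) : (0 < n)%nat -> 0 < k ->
  exists C, 0 <= C /\ forall x t h b, in_Rn n x -> k <= nsq n x <= K -> 0 <= h <= 1 ->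
    0 <= t <= b -> 1 <= b ->
    Rabs (sumR N (fun j => t ^ j / INR (fact j) * ev n (dts n j e) x 0 h)) <= C * b ^ N.
Proof.
  intros Hn Hk; induction N as [|N IH].
  - exists 0; split; [lra|]; intros; simpl; rewrite Rabs_R0; lra.
  - destruct IH as (C & HC & IH).
    destruct (ev_bounded n (dts n N e) k (K + 1) Hk) as (C' & HC' & HB).
    exists (C + C'); split; [lra|]; intros x t h b Hx Hq Hh Ht Hb; cbn [sumR].
    eapply Rle_trans; [apply Rabs_triang|].
    assert (Hbn : b ^ N <= b ^ S N) by (apply Rle_pow; [exact Hb | lia]).
    assert (Hb0 : 0 <= b ^ N) by (apply pow_le; lra).
    specialize (IH x t h b Hx Hq Hh Ht Hb).
    assert (Hev : Rabs (ev n (dts n N e) x 0 h) <= C').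
    { apply HB.
      - intros i; apply coord_bound with n; [exact Hx | lra].
      - rewrite Rabs_R0; lra.
      - rewrite Rabs_pos_eq; lra.
      - rewrite quad_0; lra. }
    assert (Htn : 0 <= t ^ N / INR (fact N) <= b ^ N).
    { pose proof (INR_fact_lt_0 N) as Hf.
      assert (1 <= INR (fact N)) by (apply (le_INR 1), lt_O_fact).
      assert (0 <= t ^ N <= b ^ N) by (split; [apply pow_le | apply pow_incr]; lra).
      split; [apply Rdiv_le_0_compat; lra|].
      apply Rle_div_l; nra. }
    rewrite Rabs_mult, (Rabs_pos_eq (t ^ N / _)) by lra.
    assert (t ^ N / INR (fact N) * Rabs (ev n (dts n N e) x 0 h) <= b ^ N * C').
    { apply Rmult_le_compat; auto using Rabs_pos; lra. }
    nra.
Qed.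

Lemma ln_le_self (q : R) : 0 < q -> ln q <= q.
Proof.
  intros Hq; pose proof (exp_ineq1_le (ln q)) as He; rewrite exp_ln in He; lra.
Qed.

Lemma scalev_in_Rn (n : nat) (l : R) (x : vec) : in_Rn n x -> in_Rn n (scalev l x).
Proof. intros Hx i Hi; unfold scalev; rewrite Hx by exact Hi; ring. Qed.

(** For t <= 1/4 this is Taylor's formula. For larger t, ln D <= D and the polynomial are each
    bounded by powers of b = 4t >= 1; no lower bound on D is needed. *)
Lemma rem_Log_upper_unit (n p : nat) : (0 < n)%nat -> (0 < p)%nat ->
  exists C, 0 < C /\ forall x t h, in_Rn n x -> nsq n x = 1 -> 0 < t -> 0 < h <= 1 ->
    rem n (2 * p) Log x t h <= C * t ^ (2 * p).
Proof.
  intros Hn Hp.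
  destruct (rem_bound n (2 * p) Log 1 1 Hn ltac:(lra)) as (C & HC & HB).
  destruct (taylor_poly_bound n (2 * p) Log 1 1 Hn ltac:(lra)) as (C' & HC' & HB').
  assert (H4 : 0 < 4 ^ (2 * p)) by (apply pow_lt; lra).
  exists (C + (3 + C') * 4 ^ (2 * p)); split; [nra|]; intros x t h Hx H1 Ht Hh.
  assert (Htp : 0 < t ^ (2 * p)) by (apply pow_lt, Ht).
  destruct (Rle_or_lt (16 * t ^ 2) 1) as [Hs|Hs].
  - pose proof (HB x t h Hx ltac:(lra) ltac:(lra) ltac:(lra) ltac:(lra)) as Hr.
    pose proof (Rle_abs (rem n (2 * p) Log x t h)).
    assert (0 <= (3 + C') * 4 ^ (2 * p) * t ^ (2 * p)) by (apply Rmult_le_pos; nra).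
    lra.
  - set (b := 4 * t).
    assert (Hb : 1 <= b) by (unfold b; nra).
    pose proof (HB' x t h b Hx ltac:(lra) ltac:(lra) ltac:(unfold b; lra) Hb) as Hr.
    replace ((C + (3 + C') * 4 ^ (2 * p)) * t ^ (2 * p)) with
      (C * t ^ (2 * p) + 3 * b ^ (2 * p) + C' * b ^ (2 * p))
      by (unfold b; rewrite Rpow_mult_distr; ring).
    assert (Hb2 : b ^ 2 <= b ^ (2 * p)) by (apply Rle_pow; [exact Hb | lia]).
    assert (Hq : quad n x t h <= 3 * b ^ 2).
    { pose proof (nsq_coord n x 0 Hn).
      assert (-1 <= x 0%nat) by nra.
      assert (t ^ 2 * (1 + h) <= 2 * t ^ 2) by (pose proof (pow2_ge_0 t); nra).
      assert (- (2 * t * x 0%nat) <= 2 * t) by nra.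
      unfold quad; rewrite H1; unfold b in *; nra. }
    pose proof (ln_le_self _ (quad_pos n x t h Hn Ht (proj1 Hh))).
    unfold rem; cbn [ev].
    set (s := sumR _ _) in *.
    assert (- s <= Rabs s) by (rewrite <- Rabs_Ropp; apply Rle_abs).
    assert (0 <= C * t ^ (2 * p)) by nra.
    lra.
Qed.

(** Scaling by 1/|x| reduces to the unit sphere. With p = m - 1 the right-hand side is a multiple of
    (t/|x|)^(n-2). *)
Lemma rem_Log_upper (n p : nat) : (0 < n)%nat -> (0 < p)%nat ->
  exists C, 0 < C /\ forall x t h, in_Rn n x -> 0 < nsq n x -> 0 < t -> 0 < h <= 1 ->
    rem n (2 * p) Log x t h <= C * (t ^ (2 * p) * (/ nsq n x) ^ p).
Proof.
  intros Hn Hp; destruct (rem_Log_upper_unit n p Hn Hp) as (C & HC & HB).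
  exists C; split; [exact HC|]; intros x t h Hx Hx0 Ht Hh.
  set (l := / sqrt (nsq n x)).
  assert (Hl : 0 < l) by (apply Rinv_0_lt_compat, sqrt_lt_R0, Hx0).
  assert (Hl2 : l ^ 2 = / nsq n x).
  { unfold l; rewrite pow_inv, pow2_sqrt; [reflexivity | lra]. }
  rewrite <- (rem_Log_scale n (2 * p) l x t h) by
    (try lia; try assumption; apply quad_pos; tauto).
  rewrite <- Hl2, <- pow_mult, (Rmult_comm (t ^ _)), <- Rpow_mult_distr.
  apply HB; auto using scalev_in_Rn.
  - rewrite nsq_scale, Hl2; field; lra.
  - apply Rmult_lt_0_compat; assumption.
Qed.

(** Scaling by 1/t reduces to t = 1. There D <= 1/16 keeps |x|^2 between 1/2 and 2, so the Taylor
    polynomial is bounded and only the logarithm remains. *)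
Lemma rem_Log_near (n N : nat) : (0 < n)%nat -> (0 < N)%nat ->
  exists C, 0 <= C /\ forall x t h, in_Rn n x -> 0 < t -> 0 < h <= 1 ->
    quad n x t h <= t ^ 2 / 16 -> rem n N Log x t h <= ln (quad n x t h / t ^ 2) + C.
Proof.
  intros Hn HN.
  destruct (taylor_poly_bound n N Log (/ 2) 2 Hn ltac:(lra)) as (C & HC & HB).
  exists C; split; [exact HC|]; intros x t h Hx Ht Hh Hq.
  pose proof (quad_ge n x t h Hn) as Hg.
  assert (Hth : 0 <= t ^ 2 * h) by (apply Rmult_le_pos; [apply pow2_ge_0 | lra]).
  assert (Hx0 : 0 < nsq n x).
  { pose proof (nsq_coord n x 0 Hn).
    assert (3 / 4 * t <= x 0%nat) by nra.
    assert (0 < x 0%nat ^ 2) by (apply pow_lt; lra); lra. }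
  assert (Hl : 0 < / t) by (apply Rinv_0_lt_compat, Ht).
  rewrite <- (rem_Log_scale n N (/ t) x t h) by (try assumption; apply quad_pos; tauto).
  replace (quad n x t h / t ^ 2) with (quad n (scalev (/ t) x) (/ t * t) h)
    by (rewrite quad_scale; field; lra).
  assert (Hq1 : quad n (scalev (/ t) x) (/ t * t) h <= / 16).
  { rewrite quad_scale, pow_inv, Rmult_comm.
    apply Rle_div_l; [apply pow_lt, Ht | lra]. }
  rewrite Rinv_l in * by lra.
  set (y := scalev (/ t) x) in *.
  assert (Hy : in_Rn n y) by (apply scalev_in_Rn, Hx).
  pose proof (quad_ge n y 1 h Hn) as Hg1.
  assert (Hy1 : / 2 <= nsq n y <= 2).
  { pose proof (nsq_coord n y 0 Hn).
    assert (3 / 4 <= y 0%nat <= 5 / 4) by (split; nra).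
    unfold quad in Hq1; split; nra. }
  pose proof (HB y 1 h 1 Hy Hy1 ltac:(lra) ltac:(lra) ltac:(lra)) as Hr.
  unfold rem; cbn [ev]; rewrite pow1 in Hr.
  set (s := sumR _ _) in *.
  assert (- s <= Rabs s) by (rewrite <- Rabs_Ropp; apply Rle_abs).
  lra.
Qed.

(** * Smooth series off the origin *)

(** The geometric tail beyond k sums to exactly C 2^(-k); the terms before J are unrestricted. *)
Lemma series_tail (a : nat -> R) (C : R) (J : nat) :
  (forall j, (J <= j)%nat -> Rabs (a j) <= C * (/ 2) ^ j) ->
  ex_series a /\ forall k, (J <= k)%nat -> Rabs (Series a - sum_f_R0 a k) <= C * (/ 2) ^ k.
Proof.
  intros Ha.
  assert (Hgeom : ex_series (fun j => (/ 2) ^ j)).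
  { apply ex_series_geom; rewrite Rabs_pos_eq; lra. }
  assert (Htail : forall k, (J <= k)%nat ->
    ex_series (fun j => Rabs (a (S k + j)%nat)) /\
    Series (fun j => Rabs (a (S k + j)%nat)) <= C * (/ 2) ^ k).
  { intros k Hk.
    assert (Hle : forall j, 0 <= Rabs (a (S k + j)%nat) <= C * (/ 2) ^ S k * (/ 2) ^ j).
    { intros j; split; [apply Rabs_pos|].
      rewrite Rmult_assoc, <- pow_add; apply Ha; lia. }
    assert (Hex : ex_series (fun j => C * (/ 2) ^ S k * (/ 2) ^ j)).
    { apply (ex_series_scal_l (C * (/ 2) ^ S k) (fun j => (/ 2) ^ j)), Hgeom. }
    split.
    - apply (ex_series_le (V := R_CompleteNormedModule)) with (2 := Hex).
      intros j; change (Rabs (Rabs (a (S k + j)%nat)) <= C * (/ 2) ^ S k * (/ 2) ^ j).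
      rewrite Rabs_Rabsolu; apply Hle.
    - eapply Rle_trans; [apply (Series_le _ _ Hle Hex)|].
      rewrite Series_scal_l, Series_geom by (rewrite Rabs_pos_eq; lra).
      simpl; lra. }
  assert (Hexa : ex_series a).
  { apply (ex_series_incr_n a (S J)), ex_series_Rabs, Htail; lia. }
  split; [exact Hexa|]; intros k Hk.
  rewrite (Series_incr_n a (S k)) by (lia || exact Hexa).
  cbn [Init.Nat.pred].
  replace (sum_f_R0 a k + _ - sum_f_R0 a k) with (Series (fun j => a (S k + j)%nat)) by ring.
  destruct (Htail k Hk) as [H1 H2].
  eapply Rle_trans; [apply Series_Rabs, H1 | exact H2].
Qed.

Lemma half_pow_small (C eps : R) (J : nat) : 0 < eps ->
  exists k, (J <= k)%nat /\ forall j, (k <= j)%nat -> C * (/ 2) ^ j < eps.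
Proof.
  intros He; destruct (pow_lt_1_zero (/ 2) ltac:(rewrite Rabs_pos_eq; lra)
    (eps / (Rabs C + 1))) as (k & Hk).
  { apply Rdiv_lt_0_compat; [exact He|]; pose proof (Rabs_pos C); lra. }
  exists (max J k); split; [lia|]; intros j Hj.
  specialize (Hk j ltac:(lia)).
  assert (Hp : 0 < (/ 2) ^ j) by (apply pow_lt; lra).
  rewrite Rabs_pos_eq in Hk by lra.
  pose proof (Rabs_pos C); pose proof (Rle_abs C).
  apply Rlt_div_r in Hk; nra.
Qed.

Lemma norm_sq (n : nat) (x : vec) : norm n x = sqrt (nsq n x).
Proof. reflexivity. Qed.

Lemma punct_nsq (n : nat) (x : vec) : punct n x <-> in_Rn n x /\ 0 < nsq n x.
Proof.
  unfold punct; rewrite norm_sq; split; intros [Hx Hp]; (split; [exact Hx|]).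
  - apply Rnot_le_lt; intros Hle; rewrite sqrt_neg_0 in Hp; lra.
  - apply sqrt_lt_R0, Hp.
Qed.

Lemma nsq_near (n : nat) (x y : vec) :
  / 2 * nsq n x - nsq n (fun i => y i - x i) <= nsq n y /\
  nsq n y <= 2 * nsq n x + 2 * nsq n (fun i => y i - x i).
Proof.
  unfold nsq; split.
  - assert (H : sumR n (fun i => / 2 * x i ^ 2 + -1 * (y i - x i) ^ 2) <= sumR n (fun i => y i ^ 2)).
    { apply sumR_le; intros i Hi; pose proof (pow2_ge_0 (2 * y i - x i)); nra. }
    rewrite sumR_plus, !sumR_scal in H; lra.
  - assert (H : sumR n (fun i => y i ^ 2) <= sumR n (fun i => 2 * x i ^ 2 + 2 * (y i - x i) ^ 2)).
    { apply sumR_le; intros i Hi; pose proof (pow2_ge_0 (y i - 2 * x i)); nra. }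
    rewrite sumR_plus, !sumR_scal in H; lra.
Qed.

Lemma norm_near (n : nat) (x y : vec) : 0 < nsq n x ->
  norm n (fun i => y i - x i) < / 2 * sqrt (nsq n x) ->
  / 4 * nsq n x <= nsq n y <= 3 * nsq n x.
Proof.
  intros Hx Hd; rewrite norm_sq in Hd.
  destruct (nsq_near n x y) as [H1 H2].
  pose proof (nsq_nonneg n (fun i => y i - x i)) as H0.
  set (s := nsq n (fun i => y i - x i)) in *.
  assert (Hs : s <= / 4 * nsq n x).
  { rewrite <- (sqrt_sqrt s H0), <- (sqrt_sqrt (nsq n x)) at 1 by lra.
    pose proof (sqrt_pos s); nra. }
  lra.
Qed.

(* Locally uniform geometric convergence on [R^n \ {0}], for all but finitely many terms. *)
Definition summable (n : nat) (G : nat -> vec -> R) : Prop :=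
  forall k K, 0 < k -> exists C J, forall j x, (J <= j)%nat -> in_Rn n x -> k <= nsq n x <= K ->
    Rabs (G j x) <= C * (/ 2) ^ j.

Lemma summable_ex_series (n : nat) (G : nat -> vec -> R) (x : vec) :
  summable n G -> punct n x -> ex_series (fun j => G j x).
Proof.
  intros HG Hx; apply punct_nsq in Hx; destruct Hx as [Hx Hp].
  destruct (HG (nsq n x) (nsq n x) Hp) as (C & J & HC).
  apply (series_tail _ C J); intros j Hj; apply HC; auto; lra.
Qed.

Lemma cont_on_plus (n : nat) (U : vec -> Prop) (f g : vec -> R) :
  cont_on n U f -> cont_on n U g -> cont_on n U (fun x => f x + g x).
Proof.
  intros Hf Hg x Hx eps He.
  destruct (Hf x Hx (eps / 2) ltac:(lra)) as (d1 & Hd1 & H1).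
  destruct (Hg x Hx (eps / 2) ltac:(lra)) as (d2 & Hd2 & H2).
  exists (Rmin d1 d2); split; [apply Rmin_pos; assumption|]; intros y Hy Hxy.
  specialize (H1 y Hy (Rlt_le_trans _ _ _ Hxy (Rmin_l d1 d2))).
  specialize (H2 y Hy (Rlt_le_trans _ _ _ Hxy (Rmin_r d1 d2))).
  replace (f y + g y - (f x + g x)) with ((f y - f x) + (g y - g x)) by ring.
  eapply Rle_lt_trans; [apply Rabs_triang | lra].
Qed.

Lemma cont_on_comp (n : nat) (U : vec -> Prop) (f : vec -> R) (p : R -> R) :
  cont_on n U f -> (forall x, U x -> continuity_pt p (f x)) -> cont_on n U (fun x => p (f x)).
Proof.
  intros Hf Hp x Hx eps He.
  destruct (proj1 (continuity_pt_locally p (f x)) (Hp x Hx) (mkposreal eps He)) as (d & Hd).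
  destruct (Hf x Hx d (cond_pos d)) as (r & Hr & Hfr).
  exists r; split; [exact Hr|]; intros y Hy Hxy; apply Hd, Hfr; assumption.
Qed.

Lemma cont_on_scal (n : nat) (U : vec -> Prop) (c : R) (f : vec -> R) :
  cont_on n U f -> cont_on n U (fun x => c * f x).
Proof.
  intros Hf; apply (cont_on_comp n U f (fun r => c * r)); [exact Hf|]; intros x Hx.
  apply continuity_pt_filterlim, (ex_derive_continuous (V := R_NormedModule)); auto_derive; auto.
Qed.

Lemma cont_on_sq (n : nat) (U : vec -> Prop) (f : vec -> R) :
  cont_on n U f -> cont_on n U (fun x => f x ^ 2).
Proof.
  intros Hf; apply (cont_on_comp n U f (fun r => r ^ 2)); [exact Hf|]; intros x Hx.
  apply continuity_pt_filterlim, (ex_derive_continuous (V := R_NormedModule)); auto_derive; auto.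
Qed.

Lemma cont_on_const (n : nat) (U : vec -> Prop) (c : R) : cont_on n U (fun _ => c).
Proof.
  intros x Hx eps He; exists 1; split; [lra|]; intros y _ _.
  rewrite Rminus_diag, Rabs_R0; exact He.
Qed.

Lemma cont_on_ext (n : nat) (U : vec -> Prop) (f g : vec -> R) :
  (forall x, f x = g x) -> cont_on n U f -> cont_on n U g.
Proof.
  intros Hfg Hf x Hx eps He; destruct (Hf x Hx eps He) as (r & Hr & H).
  exists r; split; [exact Hr|]; intros y Hy Hxy; rewrite <- !Hfg; auto.
Qed.

Lemma cont_on_mult (n : nat) (U : vec -> Prop) (f g : vec -> R) :
  cont_on n U f -> cont_on n U g -> cont_on n U (fun x => f x * g x).
Proof.
  intros Hf Hg.
  (* Polarisation reduces products to squares, hence to composition with a function of one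
     variable. *)
  apply (cont_on_ext n U (fun x => / 4 * (f x + g x) ^ 2 + - / 4 * (f x + -1 * g x) ^ 2));
    [intros x; field|].
  apply cont_on_plus; apply cont_on_scal, cont_on_sq; auto using cont_on_plus, cont_on_scal.
Qed.

Lemma cont_on_sumR (n k : nat) (U : vec -> Prop) (f : nat -> vec -> R) :
  (forall i, (i < k)%nat -> cont_on n U (f i)) -> cont_on n U (fun x => sumR k (fun i => f i x)).
Proof.
  induction k as [|k IH]; intros Hf; simpl; [apply cont_on_const|].
  apply cont_on_plus; auto.
Qed.

Lemma cont_on_coord (n i : nat) : cont_on n (punct n) (fun x => x i).
Proof.
  intros x [Hx _] eps He; exists eps; split; [exact He|]; intros y [Hy _] Hxy.
  destruct (Nat.lt_ge_cases i n) as [Hi|Hi].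
  - eapply Rle_lt_trans; [|exact Hxy]; rewrite norm_sq, <- sqrt_Rsqr_abs.
    apply sqrt_le_1_alt; rewrite Rsqr_pow2.
    apply (nsq_coord n (fun i => y i - x i) i Hi).
  - rewrite Hx, Hy, Rminus_diag, Rabs_R0 by exact Hi; exact He.
Qed.

Lemma cont_on_ev (n : nat) (e : expr) (t h : R) :
  (forall x, punct n x -> 0 < quad n x t h) -> cont_on n (punct n) (fun x => ev n e x t h).
Proof.
  intros Hq.
  assert (Hc : cont_on n (punct n) (fun x => quad n x t h)).
  { apply (cont_on_ext _ _ (fun x => nsq n x + (- 2 * t * x 0%nat + t ^ 2 * (1 + h))));
      [intros x; unfold quad; ring|].
    apply cont_on_plus; [|apply cont_on_plus].
    - apply cont_on_sumR; intros i Hi; apply cont_on_sq, cont_on_coord.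
    - apply cont_on_scal, cont_on_coord.
    - apply cont_on_const. }
  induction e; simpl; auto using cont_on_const, cont_on_coord, cont_on_plus, cont_on_mult.
  - apply (cont_on_comp n _ _ Rinv Hc); intros x Hx; specialize (Hq x Hx).
    apply continuity_pt_filterlim, (ex_derive_continuous (V := R_NormedModule)).
    auto_derive; lra.
  - apply (cont_on_comp n _ _ ln Hc); intros x Hx; specialize (Hq x Hx).
    apply continuity_pt_filterlim, (ex_derive_continuous (V := R_NormedModule)).
    auto_derive; lra.
Qed.

Lemma cont_on_Series (n : nat) (G : nat -> vec -> R) :
  (forall j, cont_on n (punct n) (G j)) -> summable n G ->
  cont_on n (punct n) (fun x => Series (fun j => G j x)).
Proof.
  intros Hc HG x Hx eps He.
  apply punct_nsq in Hx as Hx'; destruct Hx' as [Hxn Hp].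
  (* By [norm_near], the ball of radius |x|/2 around x lies in this shell. *)
  destruct (HG (/ 4 * nsq n x) (3 * nsq n x)) as (C & J & HC); [lra|].
  destruct (half_pow_small C (eps / 3) J ltac:(lra)) as (k & HkJ & Hk).
  specialize (Hk k (le_n k)).
  assert (Hs : cont_on n (punct n) (fun x => sum_f_R0 (fun j => G j x) k)).
  { clear - Hc; induction k as [|k IH]; simpl; auto using cont_on_plus. }
  destruct (Hs x Hx (eps / 3) ltac:(lra)) as (r & Hr & Hsr).
  assert (Hr2 : 0 < / 2 * sqrt (nsq n x)) by (pose proof (sqrt_lt_R0 _ Hp); lra).
  exists (Rmin r (/ 2 * sqrt (nsq n x))); split; [apply Rmin_pos; assumption|].
  intros y Hy Hxy.
  specialize (Hsr y Hy (Rlt_le_trans _ _ _ Hxy (Rmin_l _ _))).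
  pose proof (norm_near n x y Hp (Rlt_le_trans _ _ _ Hxy (Rmin_r _ _))) as Hny.
  pose proof (proj2 (series_tail (fun j => G j x) C J
    (fun j Hj => HC j x Hj Hxn ltac:(lra))) k HkJ) as Tx.
  pose proof (proj2 (series_tail (fun j => G j y) C J
    (fun j Hj => HC j y Hj (proj1 Hy) Hny)) k HkJ) as Ty.
  cbv beta in Tx, Ty, Hsr.
  apply Rabs_def2 in Hsr.
  apply Rabs_le_between in Tx; apply Rabs_le_between in Ty.
  apply Rabs_def1; lra.
Qed.

Lemma upd_upd (x : vec) (i : nat) (r s : R) : upd (upd x i r) i s = upd x i s.
Proof.
  apply functional_extensionality; intros j; unfold upd; destruct (Nat.eqb j i); reflexivity.
Qed.

Lemma upd_at (x : vec) (i : nat) (s : R) : upd x i s i = s.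
Proof. unfold upd; rewrite Nat.eqb_refl; reflexivity. Qed.

Lemma norm_upd (n i : nat) (x : vec) (s : R) : (i < n)%nat ->
  norm n (fun j => upd x i s j - x j) = Rabs (s - x i).
Proof.
  intros Hi; unfold norm; rewrite (sumR_single n _ i Hi).
  - rewrite upd_at, <- Rsqr_pow2; apply sqrt_Rsqr_abs.
  - intros j Hj; unfold upd; destruct (Nat.eqb_spec j i); [lia | ring].
Qed.

(** The differentiated series converges uniformly for |s - x_i| < |x|/2, a segment that stays away
    from the origin. *)
Lemma is_partial_Series (n i : nat) (G G' : nat -> vec -> R) : (i < n)%nat ->
  (forall j, is_partial (punct n) (G j) i (G' j)) ->
  summable n G -> summable n G' ->
  is_partial (punct n) (fun x => Series (fun j => G j x)) i (fun x => Series (fun j => G' j x)).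
Proof.
  intros Hi HP HG HG' x Hx.
  apply punct_nsq in Hx as Hx'; destruct Hx' as [Hxn Hp].
  assert (Hr : 0 < / 2 * sqrt (nsq n x)) by (pose proof (sqrt_lt_R0 _ Hp); lra).
  set (r := mkposreal _ Hr).
  assert (Hball : forall s, Boule (x i) r s ->
    in_Rn n (upd x i s) /\ / 4 * nsq n x <= nsq n (upd x i s) <= 3 * nsq n x).
  { intros s Hs; split.
    - intros j Hj; unfold upd; destruct (Nat.eqb_spec j i); [lia | apply Hxn, Hj].
    - apply norm_near; [exact Hp|]; rewrite norm_upd by exact Hi; exact Hs. }
  assert (Hball' : forall s, Boule (x i) r s -> punct n (upd x i s)).
  { intros s Hs; apply punct_nsq; destruct (Hball s Hs); split; [assumption | lra]. }
  replace (Series (fun j => G' j x)) with (Series (fun j => G' j (upd x i (x i))))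
    by (rewrite upd_same; reflexivity).
  apply (CVU_derivable (fun k s => sum_f_R0 (fun j => G j (upd x i s)) k)
    (fun k s => sum_f_R0 (fun j => G' j (upd x i s)) k)
    (fun s => Series (fun j => G j (upd x i s))) (fun s => Series (fun j => G' j (upd x i s)))
    (x i) r).
  - intros eps He.
    destruct (HG' (/ 4 * nsq n x) (3 * nsq n x)) as (C & J & HC); [lra|].
    destruct (half_pow_small C eps J He) as (k & HkJ & Hk).
    exists k; intros l s Hl Hs; destruct (Hball s Hs).
    eapply Rle_lt_trans; [|apply (Hk l Hl)].
    apply (series_tail (fun j => G' j (upd x i s)) C J); [|lia].
    intros j Hj; apply HC; assumption.
  - intros s Hs; apply is_lim_seq_Reals.
    apply (is_lim_seq_ext (sum_n (fun j => G j (upd x i s)))).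
    { intros k; apply sum_n_Reals. }
    apply Series_correct, (summable_ex_series n); auto.
  - intros k s Hs; induction k as [|k IH]; simpl.
    + pose proof (HP 0%nat _ (Hball' s Hs)) as H0.
      rewrite upd_at in H0.
      apply is_derive_Reals; apply is_derive_Reals in H0.
      eapply is_derive_ext; [|exact H0]; intros q; cbv beta; rewrite upd_upd; reflexivity.
    + apply derivable_pt_lim_plus; [exact IH|].
      pose proof (HP (S k) _ (Hball' s Hs)) as H0.
      rewrite upd_at in H0.
      apply is_derive_Reals; apply is_derive_Reals in H0.
      eapply is_derive_ext; [|exact H0]; intros q; cbv beta; rewrite upd_upd; reflexivity.
  - apply Boule_center.
Qed.

(** * The series of bubbles and its polyharmonic operator *)

(* Bubble [j] has mass [M j], centre [t j e_0] and radius [t j sqrt (h j)]. *)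
Definition admissible (m : nat) (M t h : nat -> R) : Prop :=
  (1 < m)%nat /\
  (forall j, 0 <= M j /\ 0 < t j <= (/ 2) ^ j /\ 0 < h j <= 1) /\
  exists K, forall j, M j * t j ^ (2 * (m - 1)) <= K * (/ 2) ^ j.

(** The j-th term of u is the case e = [Log], b = [epow Inv (m - 1)], since b at t = h = 0 is then
    |x|^(2-n). General e and b make the family closed under differentiation. *)
Definition term (m : nat) (M t h : nat -> R) (e b : expr) (j : nat) (x : vec) : R :=
  (/ 2) ^ S j * ev (2 * m) b x 0 0 - M j * rem (2 * m) (2 * (m - 1)) e x (t j) (h j).

Definition total (m : nat) (M t h : nat -> R) (e b : expr) (x : vec) : R :=
  Series (fun j => term m M t h e b j x).

Lemma term_summable (m : nat) (M t h : nat -> R) (e b : expr) :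
  admissible m M t h -> summable (2 * m) (term m M t h e b).
Proof.
  intros (Hm & Hj & K0 & HK0) k K Hk.
  assert (Hn : (0 < 2 * m)%nat) by lia.
  destruct (ev_bounded (2 * m) b k (Rabs K + 1) Hk) as (Cb & HCb & HB).
  destruct (rem_bound (2 * m) (2 * (m - 1)) e k K Hn Hk) as (C & HC & HR).
  (* Beyond J one has 16 t_j^2 <= 16 2^(-j) < k, so x is far enough from bubble j for the Taylor
     bound. *)
  destruct (half_pow_small 16 k 0 Hk) as (J & _ & HJ).
  exists (Cb + C * K0), J; intros j x Hjj Hx Hq.
  specialize (HJ j Hjj); specialize (HK0 j); destruct (Hj j) as (HM & Ht & Hh).
  assert (Hhalf : 0 < (/ 2) ^ j <= 1).
  { split; [apply pow_lt; lra|]. rewrite <- (pow1 j); apply pow_incr; lra. }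
  unfold term; eapply Rle_trans; [apply Rabs_triang|]; rewrite Rabs_Ropp, !Rabs_mult.
  rewrite (Rabs_pos_eq (M j)) by exact HM.
  rewrite Rabs_pos_eq by (apply pow_le; lra).
  pose proof (Rle_abs K).
  assert (H1 : Rabs (ev (2 * m) b x 0 0) <= Cb).
  { apply HB; rewrite ?quad_0, ?Rabs_R0; try lra.
    intros i; apply coord_bound with (2 * m)%nat; [exact Hx | lra]. }
  assert (H2 : Rabs (rem (2 * m) (2 * (m - 1)) e x (t j) (h j)) <= C * t j ^ (2 * (m - 1))).
  { apply HR; try lra; try assumption. nra. }
  assert (H3 : M j * Rabs (rem (2 * m) (2 * (m - 1)) e x (t j) (h j)) <= C * (K0 * (/ 2) ^ j)).
  { apply Rle_trans with (M j * (C * t j ^ (2 * (m - 1)))); [apply Rmult_le_compat_l; assumption|].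
    replace (M j * (C * t j ^ (2 * (m - 1)))) with (C * (M j * t j ^ (2 * (m - 1)))) by ring.
    apply Rmult_le_compat_l; assumption. }
  assert (H4 : (/ 2) ^ S j * Rabs (ev (2 * m) b x 0 0) <= (/ 2) ^ j * Cb).
  { apply Rmult_le_compat; auto using Rabs_pos; [apply pow_le; lra | simpl; lra]. }
  lra.
Qed.

Lemma bubble_quad_pos (m : nat) (M t h : nat -> R) (j : nat) (x : vec) : admissible m M t h ->
  0 < quad (2 * m) x (t j) (h j).
Proof. intros (Hm & Hj & _); destruct (Hj j) as (_ & Ht & Hh); apply quad_pos; lia || lra. Qed.

Lemma term_partial (m : nat) (M t h : nat -> R) (e b : expr) (i j : nat) :
  admissible m M t h -> (i < 2 * m)%nat ->
  is_partial (punct (2 * m)) (term m M t h e b j) i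
    (term m M t h (d (2 * m) (DX i) e) (d (2 * m) (DX i) b) j).
Proof.
  intros Ha Hi x Hx; apply punct_nsq in Hx; destruct Hx as [Hx Hp].
  apply is_derive_Reals.
  apply (is_derive_minus (fun s => (/ 2) ^ S j * ev (2 * m) b (upd x i s) 0 0)
    (fun s => M j * rem (2 * m) (2 * (m - 1)) e (upd x i s) (t j) (h j))).
  - apply (is_derive_scal (fun s => ev (2 * m) b (upd x i s) 0 0)).
    apply (ev_deriv (2 * m) (DX i) b x 0 0 Hi); rewrite quad_0; exact Hp.
  - apply (is_derive_scal (fun s => rem (2 * m) (2 * (m - 1)) e (upd x i s) (t j) (h j))).
    apply rem_deriv; auto; apply (bubble_quad_pos m M t h j x Ha).
Qed.

Lemma term_cont (m : nat) (M t h : nat -> R) (e b : expr) (j : nat) :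
  admissible m M t h -> cont_on (2 * m) (punct (2 * m)) (term m M t h e b j).
Proof.
  intros Ha.
  assert (H0 : forall g x, punct (2 * m) x -> 0 < quad (2 * m) x 0 g).
  { intros g x Hx; rewrite quad_0; apply punct_nsq in Hx; tauto. }
  apply (cont_on_ext _ _ (fun x => (/ 2) ^ S j * ev (2 * m) b x 0 0 +
    - M j * (ev (2 * m) e x (t j) (h j) + -1 * sumR (2 * (m - 1)) (fun k =>
      t j ^ k / INR (fact k) * ev (2 * m) (dts (2 * m) k e) x 0 (h j))))).
  { intros x; unfold term, rem; ring. }
  apply cont_on_plus; apply cont_on_scal; [apply cont_on_ev, H0|].
  apply cont_on_plus; [apply cont_on_ev; intros x Hx; apply (bubble_quad_pos m M t h j x Ha)|].
  apply cont_on_scal, cont_on_sumR; intros k Hk; apply cont_on_scal, cont_on_ev, H0.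
Qed.

Lemma total_cont (m : nat) (M t h : nat -> R) (e b : expr) : admissible m M t h ->
  cont_on (2 * m) (punct (2 * m)) (total m M t h e b).
Proof.
  intros Ha; apply (cont_on_Series (2 * m) (term m M t h e b));
    auto using term_cont, term_summable.
Qed.

Lemma total_partial (m : nat) (M t h : nat -> R) (e b : expr) (i : nat) :
  admissible m M t h -> (i < 2 * m)%nat ->
  is_partial (punct (2 * m)) (total m M t h e b) i
    (total m M t h (d (2 * m) (DX i) e) (d (2 * m) (DX i) b)).
Proof.
  intros Ha Hi; apply (is_partial_Series (2 * m) i (term m M t h e b));
    auto using term_partial, term_summable.
Qed.

(** Partial derivatives of a [total] are again of this form, so folding [d] over the list of
    directions yields all of them at once. *)
Lemma total_smooth (m : nat) (M t h : nat -> R) (e b : expr) : admissible m M t h ->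
  smooth_on (2 * m) (punct (2 * m)) (total m M t h e b).
Proof.
  intros Ha.
  set (dl := fun (l : list nat) e => List.fold_right (fun i e => d (2 * m) (DX i) e) e l).
  exists (fun l => total m M t h (dl l e) (dl l b)); split; [reflexivity|].
  intros l; split; [apply total_cont, Ha|].
  intros i Hi; apply (total_partial m M t h (dl l e) (dl l b) i Ha Hi).
Qed.

Lemma total_Add (m : nat) (M t h : nat -> R) (e1 e2 b1 b2 : expr) (x : vec) :
  admissible m M t h -> punct (2 * m) x ->
  total m M t h (Add e1 e2) (Add b1 b2) x = total m M t h e1 b1 x + total m M t h e2 b2 x.
Proof.
  intros Ha Hx; unfold total; rewrite <- Series_plus by
    (apply (summable_ex_series (2 * m)); auto using term_summable).
  apply Series_ext; intros j; unfold term; rewrite rem_Add; cbn [ev]; ring.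
Qed.

Lemma total_Cst0 (m : nat) (M t h : nat -> R) (x : vec) :
  total m M t h (Cst 0) (Cst 0) x = 0.
Proof.
  unfold total; rewrite (Series_ext _ (fun _ => 0 * 0)).
  - rewrite Series_scal_l; ring.
  - intros j; unfold term, rem; rewrite sumR_zero; [simpl; ring|].
    intros k _; replace (ev (2 * m) (dts (2 * m) k (Cst 0)) x 0 (h j)) with 0; [ring|].
    assert (Hc : dts (2 * m) k (Cst 0) = Cst 0).
    { induction k as [|k IH]; [reflexivity|].
      change (d (2 * m) DT (dts (2 * m) k (Cst 0)) = Cst 0); rewrite IH; reflexivity. }
    rewrite Hc; reflexivity.
Qed.

Lemma total_sumE (m k : nat) (M t h : nat -> R) (f g : nat -> expr) (x : vec) :
  admissible m M t h -> punct (2 * m) x ->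
  total m M t h (sumE k f) (sumE k g) x = sumR k (fun i => total m M t h (f i) (g i) x).
Proof.
  intros Ha Hx; induction k as [|k IH]; simpl; [apply total_Cst0|].
  rewrite total_Add, IH by assumption; reflexivity.
Qed.

Lemma total_lap_iter (m k : nat) (M t h : nat -> R) (e b : expr) : admissible m M t h ->
  lap_iter (2 * m) (punct (2 * m)) k (total m M t h e b)
    (total m M t h (laps (2 * m) k e) (laps (2 * m) k b)).
Proof.
  intros Ha; induction k as [|k IH]; [apply lap_iter0; reflexivity|].
  set (D := fun i => d (2 * m) (DX i)).
  apply lap_iterS with (1 := IH)
    (g1 := fun i => total m M t h (D i (laps (2 * m) k e)) (D i (laps (2 * m) k b)))
    (g2 := fun i => total m M t h (D i (D i (laps (2 * m) k e))) (D i (D i (laps (2 * m) k b)))).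
  - intros i Hi; split; apply total_partial; assumption.
  - intros x Hx; apply total_sumE; assumption.
Qed.

(** Delta^m annihilates |x|^(2-n) and the Taylor coefficients, so only Delta^m ln D is left. *)
Lemma term_laps_m (m : nat) (M t h : nat -> R) (j : nat) (x : vec) :
  admissible m M t h -> Nat.Odd m -> punct (2 * m) x ->
  term m M t h (laps (2 * m) m Log) (laps (2 * m) m (epow Inv (m - 1))) j x =
  - (M j * (4 ^ m * INR (fact (2 * m - 1)) *
            ((t j ^ 2 * h j) ^ m * (/ quad (2 * m) x (t j) (h j)) ^ (2 * m)))).
Proof.
  intros Ha Hodd Hx; apply punct_nsq in Hx; destruct Hx as [Hx Hp].
  pose proof (bubble_quad_pos m M t h j x Ha) as Hq.
  destruct Ha as (Hm & _).
  unfold term, rem; rewrite laps_power_zero by (lia || rewrite quad_0; exact Hp).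
  rewrite sumR_zero.
  - rewrite laps_Log_top by (lia || exact Hq).
    cbn [ev]; rewrite !ev_epow; cbn [ev].
    (* Here m - 1 is even. *)
    assert (Hs : 4 * (-4) ^ (m - 1) = 4 ^ m).
    { destruct Hodd as (p & Hodd); subst m.
      replace (2 * p + 1 - 1)%nat with (2 * p)%nat by lia.
      rewrite pow_mult, pow_add, pow_mult.
      replace ((-4) ^ 2) with (4 ^ 2) by ring; ring. }
    rewrite Hs; replace (t j * t j * h j) with (t j ^ 2 * h j) by ring; ring.
  - intros k Hk.
    replace (ev (2 * m) (dts (2 * m) k (laps (2 * m) m Log)) x 0 (h j)) with 0; [ring|].
    rewrite <- laps_dts_comm by (try lia; rewrite quad_0; exact Hp).
    symmetry; apply laps_dts_Log_zero; try lia; rewrite quad_0; exact Hp.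
Qed.

(** * Choice of the parameters *)

Lemma exp_quadratic (y : R) : 0 <= y -> y ^ 2 / 4 <= exp y.
Proof.
  intros Hy; replace (exp y) with (exp (y / 2) * exp (y / 2))
    by (rewrite <- exp_plus; f_equal; lra).
  pose proof (exp_ineq1_le (y / 2)); nra.
Qed.

(** In y = mu v - nu the left side is a' + b' y, which is at most y^2 / 4 once y >= 4 (|a'| + |b'|)
    + 1. It shows that L, exponential in v = ln (M/2), beats conditions that are affine in v. *)
Lemma affine_le_exp (a b mu nu : R) : 0 < mu ->
  exists v0, forall v, v0 <= v -> a + b * v <= exp (mu * v - nu).
Proof.
  intros Hmu; set (a' := a + b * nu / mu); set (b' := b / mu).
  set (Y := 4 * (Rabs a' + Rabs b') + 1).
  exists ((Y + nu) / mu); intros v Hv.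
  assert (HY : Y <= mu * v - nu) by (apply Rle_div_l in Hv; lra).
  replace (a + b * v) with (a' + b' * (mu * v - nu)) by (unfold a', b'; field; lra).
  set (y := mu * v - nu) in *.
  pose proof (Rabs_pos a'); pose proof (Rabs_pos b').
  pose proof (Rle_abs a'); pose proof (Rle_abs b').
  pose proof (exp_quadratic y ltac:(unfold Y in HY; lra)).
  unfold Y in HY; nra.
Qed.

Lemma exp_pow_INR (r : R) (k : nat) : exp r ^ k = exp (INR k * r).
Proof.
  induction k as [|k IH]; [simpl; rewrite Rmult_0_l, exp_0; reflexivity|].
  rewrite <- tech_pow_Rmult, IH, S_INR, <- exp_plus; f_equal; ring.
Qed.

(* [log (1/h)] for a bubble of mass [2 exp v]: the largest [L] for which
   [2m l <= (exp v l)^lam] on [0, L]. *)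
Definition scale_exp (m : nat) (lam v : R) : R :=
  exp ((lam * v - ln (INR (2 * m))) / (1 - lam)).

(** After taking logarithms the claim reads (1 - lam) ln l <= lam v - ln (2m). *)
Lemma scale_exp_bound (m : nat) (lam v l : R) : (0 < m)%nat -> 0 < lam < 1 ->
  0 < l <= scale_exp m lam v -> INR (2 * m) * l <= Rpower (exp v * l) lam.
Proof.
  intros Hm Hlam [Hl HlL].
  assert (HmR : 0 < INR (2 * m)) by (apply lt_0_INR; lia).
  pose proof (exp_pos v).
  unfold Rpower; rewrite ln_mult, ln_exp by assumption.
  rewrite <- (exp_ln (INR (2 * m) * l)) by (apply Rmult_lt_0_compat; assumption).
  apply ln_le in HlL; [|exact Hl].
  unfold scale_exp in HlL; rewrite ln_exp in HlL.
  apply Rle_div_r in HlL; [|lra].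
  rewrite ln_mult by assumption.
  assert (Hle : ln (INR (2 * m)) + ln l <= lam * (v + ln l)) by nra.
  destruct Hle as [Hlt|Heq]; [left; apply exp_increasing, Hlt | rewrite Heq; lra].
Qed.

Definition mass (m : nat) (eps t : R) : R := eps / t ^ (2 * (m - 1)).
(** The mass is halved because near a centre the potential is only known to exceed M l / 2; the
    other half pays for the constant of [rem_Log_near]. *)
Definition depth (m : nat) (lam eps t : R) : R := scale_exp m lam (ln (mass m eps t / 2)).

(** All conditions hold for small t: M tends to infinity and L is a positive power of M, up to a
    constant. The right-hand side of the last condition is the coefficient of t^(-(n-2)/(1-lam)) in
    M L / 2. *)
Lemma choose_scale (m : nat) (lam : R) (phi : R -> R) (eps tau q C1 Cf b : R) :
  (2 <= m)%nat -> 0 < lam < 1 ->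
  (forall eps, 0 < eps -> exists delta, 0 < delta /\
     forall r, 0 < r < delta -> Rabs (phi r) < eps) ->
  0 < eps -> 0 < tau <= 1 -> 0 < q -> 0 < Cf -> 0 < b ->
  exists t, 0 < t <= tau /\ 16 + 8 * C1 <= depth m lam eps t /\
    mass m eps t * Cf * (/ t) ^ (2 * m) <= q * exp (INR m * depth m lam eps t / 2) /\
    b * phi t < exp ((ln (eps / 2) - ln (INR (2 * m))) / (1 - lam)).
Proof.
  intros Hm Hlam Hphi Heps Htau Hq HCf Hb.
  set (mu := lam / (1 - lam)); set (nu := ln (INR (2 * m)) / (1 - lam)).
  assert (Hmu : 0 < mu) by (apply Rdiv_lt_0_compat; lra).
  assert (Hdep : forall v, scale_exp m lam v = exp (mu * v - nu)).
  { intros v; unfold scale_exp, mu, nu; f_equal; field; lra. }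
  (* Chosen so that M Cf (M/eps)^2 = q A exp (3v) when M = 2 exp v. *)
  set (A := 8 * Cf / (eps ^ 2 * q)).
  assert (HA : 0 < A).
  { apply Rdiv_lt_0_compat; [lra|]; apply Rmult_lt_0_compat; [apply pow_lt|]; assumption. }
  destruct (affine_le_exp (16 + 8 * C1) 0 mu nu Hmu) as (v1 & Hv1).
  destruct (affine_le_exp (2 * ln A) 6 mu nu Hmu) as (v2 & Hv2).
  set (rhs := exp ((ln (eps / 2) - ln (INR (2 * m))) / (1 - lam))).
  assert (Hrhs : 0 < rhs) by apply exp_pos.
  destruct (Hphi (rhs / b)) as (dphi & Hdphi & Hph); [apply Rdiv_lt_0_compat; assumption|].
  (* As t <= 1 gives M >= eps / t, the bound t <= t1 yields M / 2 >= exp v0. *)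
  set (v0 := Rmax v1 v2); set (t1 := eps / (2 * exp v0)).
  assert (Hexp : 0 < exp v0) by apply exp_pos.
  assert (Ht1 : 0 < t1) by (apply Rdiv_lt_0_compat; lra).
  set (t := Rmin tau (Rmin t1 (dphi / 2))).
  assert (Ht : 0 < t) by (unfold t; repeat apply Rmin_pos; lra).
  assert (Httau : t <= tau) by apply Rmin_l.
  assert (Htt1 : t <= t1) by (eapply Rle_trans; [apply Rmin_r | apply Rmin_l]).
  assert (Htd : t <= dphi / 2) by (eapply Rle_trans; [apply Rmin_r | apply Rmin_r]).
  set (M := mass m eps t).
  assert (Htp : 0 < t ^ (2 * (m - 1)) <= t).
  { split; [apply pow_lt, Ht|].
    replace (2 * (m - 1))%nat with (S (2 * (m - 1) - 1)) by lia.
    rewrite <- tech_pow_Rmult.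
    assert (t ^ (2 * (m - 1) - 1) <= 1 ^ (2 * (m - 1) - 1)) by (apply pow_incr; lra).
    rewrite pow1 in *; nra. }
  assert (HM : 0 < M) by (apply Rdiv_lt_0_compat; lra).
  assert (Hv : v0 <= ln (M / 2)).
  { rewrite <- (ln_exp v0); apply ln_le; [exact Hexp|].
    assert (HMt : M * t ^ (2 * (m - 1)) = eps) by (unfold M, mass; field; lra).
    assert (t * (2 * exp v0) <= eps) by (apply Rle_div_r in Htt1; lra).
    nra. }
  set (v := ln (M / 2)) in *.
  assert (HMv : M = 2 * exp v) by (unfold v; rewrite exp_ln; lra).
  specialize (Hv1 v (Rle_trans _ _ _ (Rmax_l v1 v2) Hv)).
  specialize (Hv2 v (Rle_trans _ _ _ (Rmax_r v1 v2) Hv)).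
  exists t; split; [lra|]; unfold depth; fold M v; rewrite Hdep.
  split; [lra|]; split.
  - set (L := exp (mu * v - nu)) in *.
    (* M / eps = t^(-2(m-1)), and 2m <= 4(m-1) because m >= 2. *)
    assert (HtM : (/ t) ^ (2 * m) <= (M / eps) ^ 2).
    { replace (M / eps) with ((/ t) ^ (2 * (m - 1)))
        by (unfold M, mass; rewrite pow_inv; field; lra).
      rewrite <- pow_mult; apply Rle_pow; [|lia].
      rewrite <- Rinv_1; apply Rinv_le_contravar; lra. }
    apply Rle_trans with (M * Cf * (M / eps) ^ 2).
    { apply Rmult_le_compat_l; [nra | exact HtM]. }
    replace (M * Cf * (M / eps) ^ 2) with (q * (A * exp v ^ 3))
      by (unfold A; rewrite HMv; field; lra).
    apply Rmult_le_compat_l; [lra|].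
    rewrite exp_pow_INR, <- (exp_ln A HA), <- exp_plus.
    assert (HmR : 1 <= INR m) by (apply (le_INR 1); lia).
    assert (HL : 0 < L) by apply exp_pos.
    assert (Hle : ln A + INR 3 * v <= INR m * L / 2).
    { replace (INR 3) with 3 by (simpl; ring); nra. }
    destruct Hle as [Hlt|Heq]; [left; apply exp_increasing, Hlt | rewrite Heq; lra].
  - specialize (Hph t ltac:(lra)); pose proof (Rle_abs (phi t)).
    assert (phi t < rhs / b) by lra.
    rewrite Rmult_comm; apply Rlt_div_r; assumption.
Qed.

Lemma Series_ge_term (a : nat -> R) (j : nat) :
  (forall k, 0 <= a k) -> ex_series a -> a j <= Series a.
Proof.
  intros Ha Hex.
  rewrite (Series_incr_n a (S j)) by (lia || exact Hex); cbn [Init.Nat.pred].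
  assert (Ht : 0 <= Series (fun k => a (S j + k)%nat)).
  { replace 0 with (Series (fun _ : nat => 0 * 0)) by (rewrite Series_scal_l; ring).
    apply Series_le; [intros k; split; [lra|]; rewrite Rmult_0_l; apply Ha|].
    apply (ex_series_incr_n a (S j)), Hex. }
  assert (Hs : a j <= sum_f_R0 a j).
  { destruct j; simpl; [lra|]; pose proof (cond_pos_sum a j Ha); lra. }
  lra.
Qed.

(* With [d = |x - t e_0|^2 / t^2 + h] and [l = ln (1/d)], the left-hand side is at most
   [q exp (2 m l - m L / 2)], hence at most [q] while [l <= L/4]; for larger [l] the potential
   exceeds [M l / 2] and the choice of [L] gives [2 m l <= (M l / 2)^lam]. *)
Lemma bubble_bound (m : nat) (lam M t h L q C1 Cf u : R) (x : vec) :
  (2 <= m)%nat -> 0 < lam < 1 -> in_Rn (2 * m) x -> 0 < M -> 0 < t -> 0 < h <= 1 ->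
  0 < q -> 0 < Cf -> 0 <= C1 ->
  (quad (2 * m) x t h <= t ^ 2 / 16 ->
     rem (2 * m) (2 * (m - 1)) Log x t h <= ln (quad (2 * m) x t h / t ^ 2) + C1) ->
  L = scale_exp m lam (ln (M / 2)) -> h = exp (- L) -> 16 + 8 * C1 <= L ->
  M * Cf * (/ t) ^ (2 * m) <= q * exp (INR m * L / 2) ->
  - (M * rem (2 * m) (2 * (m - 1)) Log x t h) <= u ->
  M * (Cf * ((t ^ 2 * h) ^ m * (/ quad (2 * m) x t h) ^ (2 * m))) <= q * exp (Rpower u lam).
Proof.
  intros Hm Hlam Hx HM Ht Hh Hq HCf HC1 Hnear HL HhL HL16 Hmass Hu.
  pose proof (quad_pos (2 * m) x t h ltac:(lia) Ht ltac:(lra)) as HQ.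
  pose proof (quad_ge (2 * m) x t h ltac:(lia)) as Hge.
  pose proof (pow2_ge_0 (x 0%nat - t)) as Hsq.
  assert (Ht2 : 0 < t ^ 2) by (apply pow_lt, Ht).
  set (Q := quad (2 * m) x t h) in *; set (dd := Q / t ^ 2).
  assert (Hdd : 0 < dd) by (apply Rdiv_lt_0_compat; assumption).
  assert (HdQ : Q = t ^ 2 * dd) by (unfold dd; field; lra).
  set (l := - ln dd).
  assert (Hddl : dd = exp (- l)) by (unfold l; rewrite Ropp_involutive, exp_ln; auto).
  (* D >= t^2 h caps l at L, the range of [scale_exp_bound]. *)
  assert (HlL : l <= L).
  { assert (Hhd : h <= dd) by (apply Rmult_le_reg_l with (t ^ 2); lra).
    apply ln_le in Hhd; [|lra]; rewrite HhL, ln_exp in Hhd; unfold l; lra. }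
  assert (HmR : 1 <= INR m) by (apply (le_INR 1); lia).
  (* In terms of l, (t^2 h)^m / D^(2m) equals t^(-2m) exp (2 m l - m L); half of exp (- m L) absorbs
     the prefactor M Cf t^(-2m). *)
  assert (Hf : M * (Cf * ((t ^ 2 * h) ^ m * (/ Q) ^ (2 * m))) <=
               q * exp (INR (2 * m) * l - INR m * L / 2)).
  { apply Rle_trans with (M * Cf * (/ t) ^ (2 * m) * exp (INR (2 * m) * l - INR m * L)).
    - right; rewrite HdQ, Hddl, HhL, Rinv_mult, <- exp_Ropp, !Rpow_mult_distr, !exp_pow_INR.
      unfold Rminus; rewrite exp_plus.
      replace (t ^ 2) with (/ ((/ t) ^ 2)) by (field; lra).
      rewrite Rinv_inv.
      assert (Hti : (/ t) ^ (2 * m) <> 0) by (apply pow_nonzero, Rinv_neq_0_compat; lra).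
      rewrite pow_inv, <- !pow_mult.
      replace ((/ t) ^ (2 * (2 * m))) with ((/ t) ^ (2 * m) * (/ t) ^ (2 * m))
        by (rewrite <- pow_add; f_equal; lia).
      rewrite Ropp_involutive, Ropp_mult_distr_r; field; exact Hti.
    - apply Rle_trans with (q * exp (INR m * L / 2) * exp (INR (2 * m) * l - INR m * L)).
      + apply Rmult_le_compat_r; [left; apply exp_pos | exact Hmass].
      + right; rewrite Rmult_assoc, <- exp_plus; do 2 f_equal; field. }
  eapply Rle_trans; [exact Hf|]; apply Rmult_le_compat_l; [lra|].
  assert (Hexp : forall a b, a <= b -> exp a <= exp b).
  { intros a b [Hab| ->]; [left; apply exp_increasing, Hab | lra]. }
  apply Hexp; rewrite mult_INR; simpl (INR 2).
  destruct (Rle_or_lt l (L / 4)) as [Hfar|Hcl].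
  - apply Rle_trans with 0; [nra | left; apply exp_pos].
  (* l > L/4 >= 4 and exp 1 >= 2 give dd <= 2^(-4), the threshold for the logarithmic bound. *)
  - assert (H16 : dd <= / 16).
    { rewrite Hddl, exp_Ropp; apply Rinv_le_contravar; [lra|].
      apply Rle_trans with (exp 1 ^ 4).
      - pose proof (exp_ineq1_le 1).
        replace 16 with (2 ^ 4) by ring; apply pow_incr; lra.
      - rewrite exp_pow_INR; apply Hexp; simpl; lra. }
    assert (Hr : rem (2 * m) (2 * (m - 1)) Log x t h <= - l + C1).
    { unfold l; rewrite Ropp_involutive; apply Hnear; rewrite HdQ; nra. }
    set (v := ln (M / 2)) in *.
    assert (HMv : M = 2 * exp v) by (unfold v; rewrite exp_ln; lra).
    pose proof (exp_pos v) as Hev.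
    (* l > L/4 >= 4 + 2 C1, so M (l - C1) >= M l / 2 = exp v l. *)
    assert (Hul : exp v * l <= u).
    { eapply Rle_trans; [|exact Hu]; rewrite HMv; nra. }
    pose proof (scale_exp_bound m lam v l ltac:(lia) Hlam ltac:(rewrite <- HL; lra)) as Hs.
    rewrite mult_INR in Hs; simpl (INR 2) in Hs.
    assert (Hp : Rpower (exp v * l) lam <= Rpower u lam).
    { apply Rle_Rpower_l; [lra|]; split; [nra | exact Hul]. }
    assert (0 <= INR m * L / 2) by nra.
    lra.
Qed.

Lemma Series_half : ex_series (fun j => (/ 2) ^ S j) /\ Series (fun j => (/ 2) ^ S j) = 1.
Proof.
  assert (Hg : ex_series (fun j => (/ 2) ^ j)) by (apply ex_series_geom; rewrite Rabs_pos_eq; lra).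
  split.
  - apply (ex_series_scal_l (/ 2) (fun j => (/ 2) ^ j)), Hg.
  - change (Series (fun j => / 2 * (/ 2) ^ j) = 1).
    rewrite Series_scal_l, Series_geom by (rewrite Rabs_pos_eq; lra); field.
Qed.

(** * The solution, its differential inequality and its growth at the centres *)

Theorem theorem1p10 (m : nat) (lam : R) (phi : R -> R) :
  (3 <= m)%nat -> Nat.Odd m -> 0 < lam < 1 ->
  (forall r, 0 < r < 1 -> 0 < phi r < 1) ->
  (forall r, 0 < r < 1 -> continuity_pt phi r) ->
  (forall eps, 0 < eps -> exists delta, 0 < delta /\
     forall r, 0 < r < delta -> Rabs (phi r) < eps) ->
  exists u : vec -> R,
    smooth_on (2 * m) (punct (2 * m)) u /\
    (forall x, punct (2 * m) x -> 0 < u x) /\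
    (exists w, lap_iter (2 * m) (punct (2 * m)) m u w /\
       forall x, punct (2 * m) x -> 0 <= - w x <= exp (Rpower (u x) lam)) /\
    (forall M delta, 0 < delta -> exists x,
       punct (2 * m) x /\ norm (2 * m) x < delta /\ norm (2 * m) x < 1 /\
       u x / (phi (norm (2 * m) x) *
              Rpower (norm (2 * m) x) (- (INR (2 * m) - 2) / (1 - lam))) > M).
Proof.
  intros Hm Hodd Hlam Hphi _ Hlim.
  destruct (rem_Log_upper (2 * m) (m - 1) ltac:(lia) ltac:(lia)) as (C0 & HC0 & Hup).
  destruct (rem_Log_near (2 * m) (2 * (m - 1)) ltac:(lia) ltac:(lia)) as (C1 & HC1 & Hnear).
  set (Cf := 4 ^ m * INR (fact (2 * m - 1))).
  assert (HCf : 0 < Cf) by (apply Rmult_lt_0_compat; [apply pow_lt; lra | apply INR_fact_lt_0]).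
  (* q_j is both the coefficient of |x|^(2-n) and the share of exp (u^lam) granted to bubble j. The
     factor 2 C0 makes M_j F at most half of q_j |x|^(2-n). *)
  set (q := fun j : nat => (/ 2) ^ S j); set (eps := fun j => q j / (2 * C0)).
  assert (Hq : forall j, 0 < q j) by (intros j; apply pow_lt; lra).
  assert (Heps : forall j, 0 < eps j) by (intros j; apply Rdiv_lt_0_compat; [apply Hq | lra]).
  assert (Hhalf : forall j, 0 < (/ 2) ^ j <= 1).
  { intros j; split; [apply pow_lt; lra|]; rewrite <- (pow1 j); apply pow_incr; lra. }
  (* The factor j + 1 in front of phi makes the ratios at the centres unbounded; the cap 2^(-j)
     sends the centres to the origin. *)
  destruct (functional_choice _ (fun j => choose_scale m lam phi (eps j) ((/ 2) ^ j) (q j) C1 Cf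
    (INR j + 1) ltac:(lia) Hlam Hlim (Heps j) (Hhalf j) (Hq j) HCf
    ltac:(pose proof (pos_INR j); lra))) as (t & Ht).
  set (M := fun j => mass m (eps j) (t j)).
  set (L := fun j => depth m lam (eps j) (t j)).
  set (h := fun j => exp (- L j)).
  assert (HM : forall j, 0 < M j).
  { intros j; apply Rdiv_lt_0_compat; [apply Heps | apply pow_lt, Ht]. }
  assert (HMt : forall j, M j * t j ^ (2 * (m - 1)) = eps j).
  { intros j; unfold M, mass; field; apply pow_nonzero; pose proof (proj1 (Ht j)); lra. }
  assert (Hh : forall j, 0 < h j <= 1).
  { intros j; split; [apply exp_pos|]; rewrite <- exp_0; left; apply exp_increasing.
    destruct (Ht j) as (_ & HL & _); fold (L j) in HL; lra. }
  assert (Ha : admissible m M t h).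
  { split; [lia|]; split.
    - intros j; specialize (HM j); repeat split; try apply Hh; try apply Ht; lra.
    - exists (/ (4 * C0)); intros j; rewrite HMt; unfold eps, q; simpl; right; field; lra. }
  set (B := epow Inv (m - 1)); set (g := term m M t h Log B).
  (* At least half of q_j |x|^(2-n) survives, whence positivity; the term also exceeds its own
     bubble - M_j F. *)
  assert (Hg : forall j x, punct (2 * m) x -> 0 < g j x /\
    - (M j * rem (2 * m) (2 * (m - 1)) Log x (t j) (h j)) <= g j x).
  { intros j x Hx; apply punct_nsq in Hx; destruct Hx as [Hx Hp].
    specialize (Hup x (t j) (h j) Hx Hp (proj1 (proj1 (Ht j))) (Hh j)).
    apply (Rmult_le_compat_l (M j)) in Hup; [|left; apply HM].
    set (r := rem (2 * m) (2 * (m - 1)) Log x (t j) (h j)) in *.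
    assert (Hb : 0 < (/ nsq (2 * m) x) ^ (m - 1)) by (apply pow_lt, Rinv_0_lt_compat, Hp).
    set (b := (/ nsq (2 * m) x) ^ (m - 1)) in *.
    assert (Hgj : g j x = q j * b - M j * r).
    { unfold g, term, B; rewrite ev_epow; cbn [ev]; rewrite quad_0; reflexivity. }
    assert (HMC : M j * (C0 * (t j ^ (2 * (m - 1)) * b)) = q j * b / 2).
    { transitivity (C0 * (M j * t j ^ (2 * (m - 1))) * b); [ring|].
      rewrite HMt; unfold eps; field; lra. }
    assert (0 < q j * b) by (apply Rmult_lt_0_compat; auto).
    rewrite Hgj; lra. }
  assert (Hex : forall x, punct (2 * m) x -> ex_series (fun j => g j x)).
  { intros x Hx; apply (summable_ex_series (2 * m) g); [apply term_summable, Ha | exact Hx]. }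
  set (u := total m M t h Log B).
  assert (Hgu : forall j x, punct (2 * m) x -> g j x <= u x).
  { intros j x Hx; apply (Series_ge_term (fun j => g j x)); [|apply Hex, Hx].
    intros k; left; apply Hg, Hx. }
  exists u; split; [apply total_smooth, Ha|]; split; [|split].
  - intros x Hx; apply Rlt_le_trans with (g 0%nat x); [apply Hg, Hx | apply Hgu, Hx].
  - exists (total m M t h (laps (2 * m) m Log) (laps (2 * m) m B)).
    split; [apply total_lap_iter, Ha|]; intros x Hx.
    set (f := fun j => M j * (Cf *
      ((t j ^ 2 * h j) ^ m * (/ quad (2 * m) x (t j) (h j)) ^ (2 * m)))).
    assert (Hw : - total m M t h (laps (2 * m) m Log) (laps (2 * m) m B) x = Series f).
    { unfold total; rewrite <- Series_opp; apply Series_ext; intros j.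
      unfold B; rewrite term_laps_m by assumption; apply Ropp_involutive. }
    rewrite Hw.
    (* u exceeds bubble j alone, so [bubble_bound] applies to each j; the shares q_j add up to 1. *)
    assert (Hf : forall j, 0 <= f j <= exp (Rpower (u x) lam) * q j).
    { intros j; destruct (Ht j) as (Htj & HL & Hmass & _); split.
      - pose proof (bubble_quad_pos m M t h j x Ha) as HQ.
        unfold f; left; apply Rmult_lt_0_compat; [apply HM|].
        apply Rmult_lt_0_compat; [exact HCf|]; apply Rmult_lt_0_compat; apply pow_lt.
        + apply Rmult_lt_0_compat; [apply pow_lt; lra | apply Hh].
        + apply Rinv_0_lt_compat, HQ.
      - rewrite Rmult_comm; apply (bubble_bound m lam (M j) (t j) (h j) (L j) (q j) C1);
          auto; try lia; try lra; try apply Hx.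
        + intros HQ; apply Hnear; auto; [apply Hx | lra].
        + eapply Rle_trans; [apply Hg, Hx | apply Hgu, Hx]. }
    destruct Series_half as [Hq1 Hq2].
    assert (Hexq : ex_series (fun j => exp (Rpower (u x) lam) * q j)).
    { apply (ex_series_scal_l (exp (Rpower (u x) lam)) q), Hq1. }
    assert (Hexf : ex_series f).
    { apply (ex_series_le (V := R_CompleteNormedModule)) with (2 := Hexq).
      intros j; change (Rabs (f j) <= exp (Rpower (u x) lam) * q j).
      rewrite Rabs_pos_eq; apply Hf. }
    split.
    + eapply Rle_trans; [apply (Hf 0%nat) | apply (Series_ge_term f); [apply Hf | exact Hexf]].
    + eapply Rle_trans; [apply (Series_le _ _ Hf Hexq)|].
      rewrite Series_scal_l; unfold q; rewrite Hq2; lra.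
  - intros M0 delta Hdelta.
    destruct (INR_unbounded (Rmax M0 0)) as (j0 & Hj0).
    destruct (half_pow_small 1 (Rmin delta 1) j0 ltac:(apply Rmin_pos; lra)) as (j & Hjj & Hj).
    specialize (Hj j (le_n j)); rewrite Rmult_1_l in Hj.
    apply le_INR in Hjj; pose proof (Rmax_l M0 0).
    pose proof (Rmin_l delta 1); pose proof (Rmin_r delta 1).
    destruct (Ht j) as (Htj & HL & _ & Hpeak); fold (L j) in HL.
    (* The centre t_j e_0, where D is smallest and equals t_j^2 h_j. *)
    set (x := fun i => if Nat.eqb i 0 then t j else 0).
    assert (Hxn : in_Rn (2 * m) x).
    { intros i Hi; unfold x; destruct (Nat.eqb_spec i 0); [lia | reflexivity]. }
    assert (Hns : nsq (2 * m) x = t j ^ 2).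
    { unfold nsq; apply (sumR_single (2 * m) (fun i => x i ^ 2) 0); [lia|].
      intros i Hi; unfold x; destruct (Nat.eqb_spec i 0); [lia | ring]. }
    assert (Hnorm : norm (2 * m) x = t j).
    { rewrite norm_sq, Hns; apply sqrt_pow2; lra. }
    assert (Hx : punct (2 * m) x) by (split; [exact Hxn | rewrite Hnorm; lra]).
    exists x; rewrite Hnorm; split; [exact Hx|]; split; [lra|]; split; [lra|].
    assert (Ht2 : 0 < t j ^ 2) by (apply pow_lt; lra).
    assert (HQ : quad (2 * m) x (t j) (h j) = t j ^ 2 * h j).
    { unfold quad; rewrite Hns; unfold x; simpl; ring. }
    assert (Hh16 : h j <= / 16).
    { unfold h; rewrite exp_Ropp; apply Rinv_le_contravar; [lra|].
      pose proof (exp_ineq1_le (L j)); lra. }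
    assert (Hr : rem (2 * m) (2 * (m - 1)) Log x (t j) (h j) <= - L j + C1).
    { eapply Rle_trans; [apply Hnear; auto; [lra | rewrite HQ; nra]|].
      rewrite HQ; replace (t j ^ 2 * h j / t j ^ 2) with (h j) by (field; lra).
      unfold h; rewrite ln_exp; lra. }
    (* L >= 16 + 8 C1 gives L - C1 >= L / 2. *)
    assert (Hux : M j * L j / 2 <= u x).
    { apply Rle_trans with (g j x); [|apply Hgu, Hx].
      eapply Rle_trans; [|apply Hg, Hx].
      specialize (HM j); nra. }
    set (s := - (INR (2 * m) - 2) / (1 - lam)).
    set (c := exp ((ln (eps j / 2) - ln (INR (2 * m))) / (1 - lam))) in *.
    (* L = (M/2)^(lam/(1-lam)) (2m)^(-1/(1-lam)), so M L / 2 = (M/(4m))^(1/(1-lam)), and M/2 =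
       (eps/2) t^(2-n). *)
    assert (HML : M j * L j / 2 = c * Rpower (t j) s).
    { pose proof (HM j) as HMj.
      assert (Hln : ln (M j / 2) = ln (eps j / 2) - (INR (2 * m) - 2) * ln (t j)).
      { assert (Htp : 0 < t j ^ (2 * (m - 1))) by (apply pow_lt; lra).
        replace (M j / 2) with (eps j / 2 / t j ^ (2 * (m - 1))) by (unfold M, mass; field; lra).
        pose proof (Heps j).
        rewrite ln_div, ln_pow by lra.
        replace (2 * (m - 1))%nat with (2 * m - 2)%nat by lia.
        rewrite minus_INR by lia; reflexivity. }
      transitivity (exp (ln (M j / 2)) * L j); [rewrite exp_ln by lra; field|].
      unfold L, depth, scale_exp, c, Rpower, s; fold (M j).
      rewrite <- !exp_plus, Hln; f_equal; field; lra. }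
    assert (HR : 0 < Rpower (t j) s) by apply exp_pos.
    destruct (Hphi (t j)) as [Hp0 _]; [lra|].
    apply Rlt_gt, Rlt_le_trans with (INR j + 1).
    { lra. }
    apply Rle_div_r; [apply Rmult_lt_0_compat; assumption|].
    apply Rle_trans with (c * Rpower (t j) s); [|lra].
    rewrite <- Rmult_assoc; apply Rmult_le_compat_r; lra.
Qed.
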